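(* Let $d\in\{2,3\}$, $\Delta t>0$, $\alpha\ge0$, and let $\Gamma^m\subset\mathbb R^d$ be a connected polyhedral surface with triangulation $\mathcal T^m$, vertex normals $\vec\nu_{h,p}^m$ and set of free vertices $\mathcal Q_{\rm f}^m$. Let the data $\vec k^m\in[\mathbb V^m]^d$, $\overline{\varkappa}^m\in\mathbb V^m$ and $\vec\mu_\partial^h$ be given. Assume: (A1) $\mathcal H^{d-1}(\sigma)>0$ for all $\sigma\in\mathcal T^m$; (A2) $\dim\operatorname{span}\bigl(\{\vec\nu_{h,p}^m(\vec q)\}_{\vec q\in\mathcal Q_{\rm f}^m}\bigr)=d$; (A3) $\vec\nu_{h,p}^m(\vec q)\ne\vec0$ for all $\vec q\in\mathcal Q_{\rm f}^m$. Then the fully discrete Willmore scheme has a unique solution; that is, there is exactly one $(\vec w^{m+1},\vec k^{m+1},\lambda^{m+1},\vec p^{m+1})\in[\mathbb V_0^m]^d\times[\mathbb V_1^m]^d\times\mathbb V_0^m\times[\mathbb V_0^m]^d$ such that $$\begin{aligned} 0={}&(\vec w^{m+1}\cdot\vec\nu^m,\vec\chi^h\cdot\vec\nu^m)^h_{\Gamma^m}-\mathcal B_h^m(\vec k^{m+1},\overline{\varkappa}^m;\vec\chi^h)+(P_{\Gamma^m}\vec\chi^h,\vec p^{m+1})^h_{\Gamma^m}+\alpha(\nabla_s\vec\chi^h,\nabla_s\vec p^{m+1})_{\Gamma^m},\\ 0={}&(\vec k^{m+1}+\overline{\varkappa}^m\vec\nu^m,\vec\eta^h)^h_{\Gamma^m}+(\nabla_s[\vec{\rm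 id}|_{\Gamma^m}+\Delta t\,\vec w^{m+1}],\nabla_s\vec\eta^h)_{\Gamma^m}-(\vec\mu_\partial^h,\vec\eta^h)_{\partial_2\Gamma^m},\\ 0={}&(\rho^h\vec\nu^m,\vec p^{m+1})^h_{\Gamma^m},\\ 0={}&(P_{\Gamma^m}\vec w^{m+1},\vec\xi^h)^h_{\Gamma^m}+(\lambda^{m+1}\vec\nu^m,\vec\xi^h)^h_{\Gamma^m}+\alpha(\nabla_s\vec w^{m+1},\nabla_s\vec\xi^h)_{\Gamma^m} \end{aligned}$$ for all $(\vec\chi^h,\vec\eta^h,\rho^h,\vec\xi^h)\in[\mathbb V_0^m]^d\times[\mathbb V_1^m]^d\times\mathbb V_0^m\times[\mathbb V_0^m]^d$.
   Context: Polyhedral surface: $\Gamma^m=\bigcup_{j=1}^J\overline{\sigma_j^m}\subset\mathbb R^d$, where $\mathcal T^m=\{\sigma_j^m\}_{j=1}^J$ are mutually disjoint consistently oriented $(d-1)$-simplices, with set of vertices $\mathcal Q^m=\{\vec q_k^m\}_{k=1}^K$. The boundary is $\partial\Gamma^m=\partial_1\Gamma^m\cup\partial_2\Gamma^m$ (disjoint partition; all boundary sets are empty for closed surfaces). If $\vec q_{j_0}^m,\dots,\vec q_{j_{d-1}}^m$ are the consistently oriented vertices of $\sigma_j^m$, the elementwise constant unit normal is $\vec\nu^m|_{\sigma_j^m}=\vec\nu_j^m=\vec N/|\vec N|$ with $\vec N=(\vec q_{j_1}^m-\vec q_{j_0}^m)\wedge\cdots\wedge(\vec q_{j_{d-1}}^m-\vec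 q_{j_0}^m)$ (generalized wedge product giving an oriented normal vector). $P_{\Gamma^m}={\rm Id}-\vec\nu^m\otimes\vec\nu^m$ elementwise. $\mathcal Q_{\rm f}^m=\{\vec q\in\mathcal Q^m:\vec q\notin\partial\Gamma^m\}$ is the set of free vertices. With $\mathcal I_k^m=\{j:\vec q_k^m\in\overline{\sigma_j^m}\}$, the vertex normal $\vec\nu_{h,p}^m\in[\mathbb V^m]^d$ is given by $$\vec\nu_{h,p}^m(\vec q_k^m)=\frac{\sum_{j\in\mathcal I_k^m}\mathcal H^{d-1}(\sigma_j^m)\,\vec\nu_j^m}{\sum_{j\in\mathcal I_k^m}\mathcal H^{d-1}(\sigma_j^m)},\qquad k=1,\dots,K.$$ Spaces: $\mathbb V^m$ = continuous functions on $\Gamma^m$ affine on each simplex; $\mathbb V_0^m$ (resp. $\mathbb V_1^m$) = those vanishing on $\partial\Gamma^m$ (resp. on $\partial_1\Gamma^m$). $\vec\mu_\partial^h$ is a given continuous piecewise affine vector field on $\partial_2\Gamma^m$ (trace of an element of $[\mathbb V^m]^d$). Inner products: $(f,g)_{\Gamma^m}$ is the $L^2$ inner product on $\Gamma^m$, $(\cdot,\cdot)_{\partial_2\Gamma^m}$ the one on $\partial_2\Gamma^m$, and the mass-lumped inner product is $(f,g)^h_{\Gamma^m}=\frac1d\sum_j\mathcal H^{d-1}(\sigma_j^m)\sum_{k=0}^{d-1}\lim_{\sigma_j^m\ni\vec x\to\vec q_{j_k}^m}f(\vec x)g(\vec x)$; both extend to vectors and matrices (with $A:B={\rm tr}(A^TB)$).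 Notation: $\nabla_s$ is the elementwise surface gradient, $(\nabla_s\vec\varphi)_{ij}$ the $j$-th component of $\nabla_s\varphi_i$, $\nabla_s\cdot\vec\varphi={\rm tr}\nabla_s\vec\varphi$, $\mathcal D(\vec\eta)=\nabla_s\vec\eta+(\nabla_s\vec\eta)^T$, $\vec{\rm id}$ the identity map on $\Gamma^m$. $\mathcal C_h^m(\overline{\varkappa}^m;\vec\eta^h)\in\mathbb V^m$ is defined by $(\mathcal C_h^m(\overline{\varkappa}^m;\vec\eta^h),\chi^h)^h_{\Gamma^m}=(\vec\eta^h\cdot\nabla_s\overline{\varkappa}^m,\chi^h)^h_{\Gamma^m}$ for all $\chi^h\in\mathbb V^m$. The form $\mathcal B_h^m$ is $\mathcal B_h^m(\vec k,\overline{\varkappa}^m;\vec\eta)=(\nabla_s\vec k,\nabla_s\vec\eta)_{\Gamma^m}+\mathcal R_h^m(\vec\eta)$ with $$\begin{aligned}\mathcal R_h^m(\vec\eta)={}&(\nabla_s\cdot\vec k^m,\nabla_s\cdot\vec\eta)_{\Gamma^m}-((\nabla_s\vec k^m)^T,\mathcal D(\vec\eta)(\nabla_s\vec{\rm id})^T)^h_{\Gamma^m}\\&+((\vec k^m+\overline{\varkappa}^m\vec\nu^m)\cdot\vec k^m-\tfrac12|\vec k^m|^2,\nabla_s\vec{\rm id}:\nabla_s\vec\eta)^h_{\Gamma^m}\\&-(\overline{\varkappa}^m\vec k^m,(\nabla_s\vec\eta)^T\vec\nu^m)^h_{\Gamma^m}+(\mathcal C_h^m(\overline{\varkappa}^m;\vec\eta)\vec\nu^m,\vec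 k^m)^h_{\Gamma^m}.\end{aligned}$$ *)

(* Defs.v *)
From HB Require Import structures.
From mathcomp Require Import all_boot all_order all_algebra all_fingroup.
From mathcomp Require Import all_classical all_reals all_analysis.

Set Implicit Arguments.
Unset Strict Implicit.
Unset Printing Implicit Defensive.

Import Order.TTheory GRing.Theory Num.Theory.
Import numFieldNormedType.Exports.

Local Open Scope classical_set_scope.
Local Open Scope ring_scope.

Section Vectors.
Variable R : realType.

Definition dotv {m : nat} (x y : 'rV[R]_m) : R := \sum_i x 0 i * y 0 i.

Definition enorm {m : nat} (x : 'rV[R]_m) : R := Num.sqrt (dotv x x).

                                  
Definition frob {m : nat} (A B : 'M[R]_m) : R := \tr (A^T *m B).

                                                                       
                                                               
Definition wedge {m : nat} (A : 'M[R]_(m, m.+1)) : 'rV[R]_m.+1 :=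
  \row_i \det (col_mx (delta_mx 0 i) A : 'M[R]_(1 + m)).

Definition edges {m d : nat} (v : 'I_m.+1 -> 'rV[R]_d) : 'M[R]_(m, d) :=
  \matrix_i (v (lift ord0 i) - v ord0).

                                                                               
                                                                             
Definition jacobian {m d : nat} (v : 'I_m.+1 -> 'rV[R]_d) : R :=
  Num.sqrt (\det (edges v *m (edges v)^T)).

Definition simplex_measure {m d : nat} (v : 'I_m.+1 -> 'rV[R]_d) : R :=
  jacobian v / (m`!)%:R.

                                                                           
                                                   
Fixpoint ref_integral (m : nat) (r : R) : ('rV[R]_m -> R) -> R :=
  match m with
  | 0 => fun f => f 0
  | m'.+1 => fun f =>
      \int[lebesgue_measure]_(x in `]0, r[)
        ref_integral (r - x) (fun s : 'rV[R]_m' =>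
          f (row_mx (x%:M : 'M[R]_1) s : 'rV[R]_(1 + m')))
  end.

Definition simplex_integral {m d : nat} (v : 'I_m.+1 -> 'rV[R]_d)
    (f : 'rV[R]_d -> R) : R :=
  jacobian v * ref_integral 1 (fun t : 'rV[R]_m => f (v ord0 + t *m edges v)).

End Vectors.

                                                                               
                                                                            
                                          
Record triangulation (R : realType) (n : nat) := Triangulation {
  nvert : nat;
  nsimp : nat;
  vertex : 'I_nvert -> 'rV[R]_n.+2;
  simp : 'I_nsimp -> 'I_n.+2 -> 'I_nvert;
  bfacets1 : {set 'I_nsimp * 'I_n.+2};
  bfacets2 : {set 'I_nsimp * 'I_n.+2}
}.

Section Surface.
Variables (R : realType) (n : nat) (T : triangulation R n).

Notation E := 'rV[R]_n.+2.
Notation J := 'I_(nsimp T).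
Notation K := 'I_(nvert T).
Notation facet := (J * 'I_n.+2)%type.

Definition simp_pt (j : J) (l : 'I_n.+2) : E := vertex (simp j l).
Definition facet_pt (F : facet) (l : 'I_n.+1) : E := simp_pt F.1 (lift F.2 l).

Definition simp_verts (j : J) : {set K} := [set simp j l | l : 'I_n.+2].
Definition facet_verts (F : facet) : {set K} :=
  [set simp F.1 (lift F.2 l) | l : 'I_n.+1].

Definition hull (S : {set K}) : set E := [set x | exists c : K -> R,
  [/\ forall k, k \in S -> 0 <= c k, \sum_(k in S) c k = 1
    & x = \sum_(k in S) c k *: vertex k]].

Definition open_hull (S : {set K}) : set E := [set x | exists c : K -> R,
  [/\ forall k, k \in S -> 0 < c k, \sum_(k in S) c k = 1
    & x = \sum_(k in S) c k *: vertex k]].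

Definition osimplex (j : J) : set E := open_hull (simp_verts j).
Definition csimplex (j : J) : set E := hull (simp_verts j).

Definition Gam : set E := \bigcup_(j in [set: J]) csimplex j.

                                                      
Definition bfacets : {set facet} :=
  [set F | [forall j : J, (facet_verts F \subset simp_verts j) ==> (j == F.1)]].

Definition facets_union (B : {set facet}) : set E :=
  \bigcup_(F in [set` B]) hull (facet_verts F).

Definition bd : set E := facets_union bfacets.
Definition bd1 : set E := facets_union (bfacets1 T).
Definition bd2 : set E := facets_union (bfacets2 T).

                                                                            
                                                                
Definition consistently_oriented : Prop :=
  forall (F G : facet) (s : 'S_n.+1), F.1 != G.1 ->
    (forall l, simp F.1 (lift F.2 l) = simp G.1 (lift G.2 (s l))) ->
    odd (F.2 + odd_perm s + G.2).

Record polyhedral_surface : Prop := PolyhedralSurface {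
  vertex_inj : injective (@vertex R n T);
  simp_inj : forall j, injective (@simp R n T j);
  vertex_used : forall k, exists j, k \in simp_verts j;
  simp_disjoint : forall i j, i != j -> osimplex i `&` osimplex j = set0;
                           
  simp_conforming : forall i j,
    csimplex i `&` csimplex j = hull (simp_verts i :&: simp_verts j)%SET;
  simp_oriented : consistently_oriented;
  bd_cover : (bfacets1 T :|: bfacets2 T)%SET = bfacets;
  bd_disjoint : (bfacets1 T :&: bfacets2 T)%SET = finset.set0
}.

Definition simp_measure (j : J) : R := simplex_measure (simp_pt j).

Definition nu (j : J) : E :=
  let N := wedge (edges (simp_pt j)) in (enorm N)^-1 *: N.

Definition Pmx (j : J) : 'M[R]_n.+2 := 1%:M - (nu j)^T *m nu j.

                                                               
Definition Pv (j : J) (v : E) : E := (Pmx j *m v^T)^T.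

Definition free_vertex (k : K) : Prop := ~ bd (vertex k).

(* The value of the piecewise affine vertex normal field at the k-th vertex. *)
Definition vertex_normal (k : K) : E :=
  (\sum_(j | `[< csimplex j (vertex k) >]) simp_measure j)^-1 *:
  \sum_(j | `[< csimplex j (vertex k) >]) simp_measure j *: nu j.

                                                                            
                                                                  
Definition V : set (E -> R) := [set f |
  [/\ {within Gam, continuous f},
      forall j, exists (a : E) (b : R), forall x, csimplex j x ->
        f x = dotv a x + b
    & forall x, ~ Gam x -> f x = 0]].

Definition V0 : set (E -> R) := [set f | V f /\ forall x, bd x -> f x = 0].
Definition V1 : set (E -> R) := [set f | V f /\ forall x, bd1 x -> f x = 0].

Definition vec (W : set (E -> R)) : set (E -> E) :=
  [set f | forall i, W (fun x => f x 0 i)].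

                                                                     
                                                                         
                                                                      
Definition sgrad (f : E -> R) (j : J) (x : E) : E :=
  \row_i 'D_(row i (Pmx j)) f x.

Definition sgradv (f : E -> E) (j : J) (x : E) : 'M[R]_n.+2 :=
  \matrix_i sgrad (fun y => f y 0 i) j x.

Definition sdiv (f : E -> E) (j : J) (x : E) : R := \tr (sgradv f j x).

Definition Dsym (f : E -> E) (j : J) (x : E) : 'M[R]_n.+2 :=
  sgradv f j x + (sgradv f j x)^T.

                                                                         
                                                                        
Definition L2 (h : J -> E -> R) : R :=
  \sum_(j : J) simplex_integral (simp_pt j) (h j).

Definition lumped (h : J -> E -> R) : R :=
  (n.+2%:R)^-1 * \sum_(j : J) simp_measure j *
    \sum_(l < n.+2) lim (h j x @[x --> within (osimplex j) (nbhs (simp_pt j l))]).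

Definition L2_bd2 (h : E -> R) : R :=
  \sum_(F in bfacets2 T) simplex_integral (facet_pt F) h.

(* The element of V determined by its lumped products against V. *)
Definition Ch (kap : E -> R) (eta : E -> E) : E -> R :=
  xget (fun=> 0) [set c | V c /\ forall chi, V chi ->
    lumped (fun j x => c x * chi x) =
    lumped (fun j x => dotv (eta x) (sgrad kap j x) * chi x)].

Definition Rh (km : E -> E) (kap : E -> R) (eta : E -> E) : R :=
  L2 (fun j x => sdiv km j x * sdiv eta j x)
  - lumped (fun j x =>
      frob (sgradv km j x)^T (Dsym eta j x *m (sgradv id j x)^T))
  + lumped (fun j x =>
      (dotv (km x + kap x *: nu j) (km x) - 2^-1 * dotv (km x) (km x)) *
      frob (sgradv id j x) (sgradv eta j x))
  - lumped (fun j x =>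
      dotv (kap x *: km x) ((sgradv eta j x)^T *m (nu j)^T)^T)
  + lumped (fun j x => dotv (Ch kap eta x *: nu j) (km x)).

Definition Bh (km : E -> E) (k : E -> E) (kap : E -> R) (eta : E -> E) : R :=
  L2 (fun j x => frob (sgradv k j x) (sgradv eta j x)) + Rh km kap eta.

Definition willmore_scheme (dt alpha : R) (km : E -> E) (kap : E -> R)
    (mu : E -> E) (w k : E -> E) (lam : E -> R) (p : E -> E) : Prop :=
  forall (chi eta : E -> E) (rho : E -> R) (xi : E -> E),
    vec V0 chi -> vec V1 eta -> V0 rho -> vec V0 xi ->
  [/\ 0 = lumped (fun j x => dotv (w x) (nu j) * dotv (chi x) (nu j))
          - Bh km k kap chi
          + lumped (fun j x => dotv (Pv j (chi x)) (p x))
          + alpha * L2 (fun j x => frob (sgradv chi j x) (sgradv p j x)),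
      0 = lumped (fun j x => dotv (k x + kap x *: nu j) (eta x))
          + L2 (fun j x =>
              frob (sgradv (fun y => y + dt *: w y) j x) (sgradv eta j x))
          - L2_bd2 (fun x => dotv (mu x) (eta x)),
      0 = lumped (fun j x => dotv (rho x *: nu j) (p x))
    & 0 = lumped (fun j x => dotv (Pv j (w x)) (xi x))
          + lumped (fun j x => dotv (lam x *: nu j) (xi x))
          + alpha * L2 (fun j x => frob (sgradv w j x) (sgradv xi j x))].

End Surface.

(* Main.v *)
Require Import Defs.
From HB Require Import structures.
From mathcomp Require Import all_boot all_order all_algebra all_fingroup.
From mathcomp Require Import all_classical all_reals all_analysis.
From mathcomp Require Import ring lra.

Set Implicit Arguments.
Unset Strict Implicit.
Unset Printing Implicit Defensive.

Import Order.TTheory GRing.Theory Num.Theory.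
Import numFieldNormedType.Exports.

Local Open Scope classical_set_scope.
Local Open Scope ring_scope.

(** The scheme is a square linear system in finitely many unknowns, so existence
follows from uniqueness, and uniqueness from an energy argument.

Reduction to nodal values. A finite element function is determined by its
values at the vertices ([nodalK]), and every choice of values is attained
([V_interp], where conformity of the triangulation makes the affine pieces fit
together). The boundary conditions are conditions on nodal values. Surface
gradients are constant on each open simplex ([sgradv_V]), so the exact integrals
of gradient products are weighted sums over the simplices ([L2E]); the limits in
the lumped products are vertex values ([lumpedE]). Thus the scheme becomes a
linear system for the nodal values ([schemeE]). Its right-hand side has to be
linear in the test fields: for the explicit terms this uses the nodal formula
for the transport term ([Ch_spec]), for the boundary term the integrability of
continuous functions on the boundary facets ([boundary_lin]).

Uniqueness ([homogeneous_trivial]). Testing the homogeneous equations with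
the solution, all cross terms cancel and the lumped norms of the curvature and of
the normal velocity vanish. Hence the curvature is zero; the second equation then
says that the velocity has zero surface gradient, so it is constant on the
connected surface. A constant whose normal components vanish is orthogonal to the
vertex normals, which span the space, so the velocity is zero. The fourth
equation now reduces to its multiplier term, which is a sum over vertices of
multiples of the nonzero vertex normals; so the multiplier is zero. The first
equation leaves the adjoint velocity without tangential part at each vertex,
parallel to all adjacent normals and hence to the vertex normal, whereas the
third equation makes it orthogonal to the vertex normal.

Existence. On the finite-dimensional space of admissible nodal values, an
injective square system is solvable ([galerkin_solvable]). *)

(** * Linear functionals and square linear systems *)

Section Linear_functionals.
Variable R : comNzRingType.

(** A predicate on bare functions, so that linearity of explicit expressions
follows from closure rules. *)
Definition lin (U : lmodType R) (f : U -> R) : Prop :=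
  forall c u v, f (c *: u + v) = c * f u + f v.

Variable U : lmodType R.
Implicit Types f g : U -> R.

Lemma linD f g : lin f -> lin g -> lin (fun u => f u + g u).
Proof. by move=> hf hg c u v; rewrite hf hg; ring. Qed.

Lemma linN f : lin f -> lin (fun u => - f u).
Proof. by move=> hf c u v; rewrite hf; ring. Qed.

Lemma linMl c f : lin f -> lin (fun u => c * f u).
Proof. by move=> hf d u v; rewrite hf; ring. Qed.

Lemma linMr c f : lin f -> lin (fun u => f u * c).
Proof. by move=> hf d u v; rewrite hf; ring. Qed.

Lemma lin_sum (I : Type) (r : seq I) (P : pred I) (F : I -> U -> R) :
  (forall i, lin (F i)) -> lin (fun u => \sum_(i <- r | P i) F i u).
Proof.
move=> hF c u v; rewrite mulr_sumr -big_split /=.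
by apply: eq_bigr => i _; rewrite hF.
Qed.

Lemma lin_comp (W : lmodType R) (f : U -> R) (g : W -> U) :
  lin f -> (forall c u v, g (c *: u + v) = c *: g u + g v) ->
  lin (fun u => f (g u)).
Proof. by move=> hf hg c u v; rewrite hg hf. Qed.

Lemma lin0 f : lin f -> f 0 = 0.
Proof.
move=> hf; have := hf 1 0 0; rewrite scale1r addr0 mul1r => h.
by apply: (addrI (f 0)); rewrite -h addr0.
Qed.

Lemma lin_lincomb f n (c : 'I_n -> R) (b : 'I_n -> U) :
  lin f -> f (\sum_i c i *: b i) = \sum_i c i * f (b i).
Proof.
move=> hf; elim/big_rec2: _ => [|i x y _ <-]; first exact: lin0.
by rewrite hf.
Qed.

Lemma linB f u v : lin f -> f (u - v) = f u - f v.
Proof. by move=> hf; rewrite addrC -scaleN1r hf; ring. Qed.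

End Linear_functionals.

(** In a basis of [S] the form is a square matrix; the hypothesis says that its
kernel is trivial, so it is invertible. *)
Lemma galerkin_solvable (F : fieldType) (U : vectType F) (S : {vspace U})
    (a : U -> U -> F) (l : U -> F) :
  (forall t, lin (a ^~ t)) -> (forall s, lin (a s)) -> lin l ->
  (forall s, s \in S -> (forall t, t \in S -> a s t = 0) -> s = 0) ->
  exists2 s, s \in S & forall t, t \in S -> a s t = l t.
Proof.
move=> al ar hl inj.
pose X := vbasis S; pose b i := X`_i.
have bS i : (i < \dim S)%N -> b i \in S.
  by move=> ilt; apply: vbasis_mem; rewrite mem_nth // size_tuple.
pose A := \matrix_(i < \dim S, k < \dim S) a (b i) (b k).
pose vec_of (c : 'rV_(\dim S)) := \sum_(i < \dim S) c 0 i *: b i.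
have vS c : vec_of c \in S by apply: memv_suml => i _; rewrite memvZ ?bS.
have aE c (t : 'I_(\dim S)) : a (vec_of c) (b t) = (c *m A) 0 t.
  rewrite (lin_lincomb _ _ (al (b t))) mxE.
  by apply: eq_bigr => i _; rewrite mxE.
have span t : t \in S -> t = \sum_(i < \dim S) coord X i t *: b i.
  by move=> tS; rewrite {1}(coord_vbasis tS).
have Afree : A \in unitmx.
  rewrite -row_free_unit; apply/row_freeP/row_freeP/inj_row_free => c cA.
  have /inj : vec_of c \in S by [].
  have h0 t : t \in S -> a (vec_of c) t = 0.
    move=> /span ->; rewrite (lin_lincomb _ _ (ar _)) big1 // => i _.
    by rewrite aE cA mxE mulr0.
  move=> /(_ h0) c0; apply/rowP => i; rewrite mxE.
  have /freeP := basis_free (vbasisP S).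
  by move=> /(_ (fun i => c 0 i) c0 i).
pose c := (\row_i l (b i)) *m invmx A.
exists (vec_of c) => // t /span ->.
rewrite (lin_lincomb _ _ (ar _)) (lin_lincomb _ _ hl); apply: eq_bigr => i _.
by rewrite aE /c mulmxKV // mxE.
Qed.

(** * Dot products and wedge products *)

Section Dot_products.
Variable R : realType.

Lemma dotvC m (x y : 'rV[R]_m) : dotv x y = dotv y x.
Proof. by apply: eq_bigr => i _; rewrite mulrC. Qed.

Lemma dotvDl m (x y z : 'rV[R]_m) : dotv (x + y) z = dotv x z + dotv y z.
Proof.
by rewrite -big_split; apply: eq_bigr => i _; rewrite mxE mulrDl.
Qed.

Lemma dotvZl m c (x y : 'rV[R]_m) : dotv (c *: x) y = c * dotv x y.
Proof. by rewrite mulr_sumr; apply: eq_bigr => i _; rewrite mxE mulrA. Qed.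

Lemma dotvZr m c (x y : 'rV[R]_m) : dotv x (c *: y) = c * dotv x y.
Proof. by rewrite dotvC dotvZl dotvC. Qed.

Lemma dotvNl m (x y : 'rV[R]_m) : dotv (- x) y = - dotv x y.
Proof. by rewrite -scaleN1r dotvZl mulN1r. Qed.

Lemma dotvBl m (x y z : 'rV[R]_m) : dotv (x - y) z = dotv x z - dotv y z.
Proof. by rewrite dotvDl dotvNl. Qed.

Lemma dotvDr m (x y z : 'rV[R]_m) : dotv z (x + y) = dotv z x + dotv z y.
Proof. by rewrite dotvC dotvDl !(dotvC z). Qed.

Lemma dotvBr m (x y z : 'rV[R]_m) : dotv z (x - y) = dotv z x - dotv z y.
Proof. by rewrite dotvC dotvBl !(dotvC z). Qed.

Lemma dotv0l m (x : 'rV[R]_m) : dotv 0 x = 0.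
Proof. by rewrite -(scale0r 0) dotvZl mul0r. Qed.

Lemma dotv0r m (x : 'rV[R]_m) : dotv x 0 = 0.
Proof. by rewrite dotvC dotv0l. Qed.

Lemma dotv_suml m (I : Type) (r : seq I) (P : pred I) (F : I -> 'rV[R]_m) y :
  dotv (\sum_(i <- r | P i) F i) y = \sum_(i <- r | P i) dotv (F i) y.
Proof.
elim/big_rec2: _ => [|i a b _ <-]; first exact: dotv0l.
by rewrite dotvDl.
Qed.

Lemma dotv_sumr m (I : Type) (r : seq I) (P : pred I) (F : I -> 'rV[R]_m) y :
  dotv y (\sum_(i <- r | P i) F i) = \sum_(i <- r | P i) dotv y (F i).
Proof. by rewrite dotvC dotv_suml; apply: eq_bigr => i _; rewrite dotvC. Qed.

Lemma dotv_ge0 m (x : 'rV[R]_m) : 0 <= dotv x x.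
Proof. by apply: sumr_ge0 => i _; rewrite -expr2 sqr_ge0. Qed.

Lemma dotv_eq0 m (x : 'rV[R]_m) : dotv x x = 0 -> x = 0.
Proof.
move=> /eqP; rewrite psumr_eq0 => [/allP h|i _]; last by rewrite -expr2 sqr_ge0.
apply/rowP => i; rewrite mxE; have := h i; rewrite mem_index_enum => /(_ isT).
by rewrite -expr2 sqrf_eq0 => /eqP.
Qed.

Lemma dotv_delta m (x : 'rV[R]_m) i : dotv x (delta_mx 0 i) = x 0 i.
Proof.
rewrite /dotv (bigD1 i) //= big1 ?mxE ?eqxx ?mulr1 ?addr0 // => k ki.
by rewrite mxE (negbTE ki) mulr0.
Qed.

Lemma dotv_deltal m (x : 'rV[R]_m) i : dotv (delta_mx 0 i) x = x 0 i.
Proof. by rewrite dotvC dotv_delta. Qed.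

Lemma dotvE m (x y : 'rV[R]_m) : dotv x y = (x *m y^T) 0 0.
Proof. by rewrite mxE; apply: eq_bigr => i _; rewrite mxE. Qed.

Lemma frobE m (A B : 'M[R]_m) : frob A B = \sum_i \sum_k A k i * B k i.
Proof.
apply: eq_bigr => i _; rewrite mxE.
by apply: eq_bigr => k _; rewrite mxE.
Qed.

Lemma frob_ge0 m (A : 'M[R]_m) : 0 <= frob A A.
Proof.
by rewrite frobE; do 2 apply: sumr_ge0 => ? _; rewrite -expr2 sqr_ge0.
Qed.

Lemma frob_eq0 m (A : 'M[R]_m) : frob A A = 0 -> A = 0.
Proof.
rewrite frobE pair_big /= => /eqP; rewrite psumr_eq0 => [/allP h|i _]; last first.
  by rewrite -expr2 sqr_ge0.
apply/matrixP => k i; rewrite mxE.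
have := h (i, k); rewrite mem_index_enum => /(_ isT) /=.
by rewrite -expr2 sqrf_eq0 => /eqP.
Qed.

Lemma frobC m (A B : 'M[R]_m) : frob A B = frob B A.
Proof. by rewrite !frobE; do 2 apply: eq_bigr => ? _; rewrite mulrC. Qed.

End Dot_products.

(** The Gram matrix is block diagonal. *)
Lemma gram_col_mx (R : realType) m q (u : 'rV[R]_q) (A : 'M[R]_(m, q)) :
  u *m A^T = 0 ->
  \det (col_mx u A *m (col_mx u A)^T) = dotv u u * \det (A *m A^T).
Proof.
move=> uA; rewrite tr_col_mx mul_col_row uA.
have -> : A *m u^T = 0 by rewrite -[A]trmxK -trmx_mul uA trmx0.
by rewrite det_ublock (mx11_scalar (u *m _)) det_scalar1 -dotvE.
Qed.

Section Wedge.
Variables (R : realType) (m : nat) (A : 'M[R]_(m, m.+1)).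

(** Both sides expand along the first row with the same cofactors. *)
Lemma dotv_wedge (u : 'rV[R]_m.+1) :
  dotv u (wedge A) = \det (col_mx u A : 'M[R]_(1 + m)).
Proof.
rewrite (expand_det_row _ (lshift m 0 : 'I_(1 + m))).
apply: eq_bigr => i _; congr (_ * _); first by rewrite col_mxEu.
rewrite mxE (expand_det_row _ (lshift m 0 : 'I_(1 + m))) (bigD1 i) //= big1.
  rewrite addr0 col_mxEu mxE !eqxx mul1r /cofactor; congr (_ * \det _).
  apply/matrixP => a b; rewrite [LHS]mxE [RHS]mxE [LHS]mxE [RHS]mxE.
  have -> : lift (lshift m 0 : 'I_(1 + m)) a = rshift 1 a by apply: val_inj.
  by rewrite !col_mxEd.
by move=> k ki; rewrite col_mxEu mxE (negbTE ki) mul0r.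
Qed.

Lemma wedge_orth i : dotv (row i A) (wedge A) = 0.
Proof.
rewrite dotv_wedge.
apply: (@determinant_alternate _ _ _ (lshift m 0 : 'I_(1 + m)) (rshift 1 i)).
  by rewrite -val_eqE.
by move=> k; rewrite col_mxEu col_mxEd mxE.
Qed.

(** For dimension reasons some [u != 0] is orthogonal to the rows of [A]; then
[det (u; A) ^ 2 = |u| ^ 2 det (A A^T)] does not vanish, and neither can the
functional [det (_; A)], which is the dot product with [wedge A]. *)
Lemma wedge_neq0 : \det (A *m A^T) != 0 -> wedge A != 0.
Proof.
move=> hdet.
have [u /eqP uA u0] : exists2 u : 'rV[R]_m.+1, u *m A^T == 0 & u != 0.
  have : kermx A^T != 0.
    rewrite -mxrank_eq0 mxrank_ker -lt0n subn_gt0 ltnS mxrank_tr.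
    exact: rank_leq_row.
  by move=> /rowV0Pn [u /sub_kermxP uA u0]; exists u; rewrite ?uA.
apply/eqP => w0.
have := dotv_wedge u; rewrite w0 dotv0r => /esym d0.
have : \det ((col_mx u A : 'M[R]_(1 + m)) *m (col_mx u A)^T) = 0.
  by rewrite det_mulmx d0 mul0r.
rewrite (gram_col_mx uA) => /eqP.
rewrite mulf_eq0 (negbTE hdet) orbF => /eqP /dotv_eq0 /eqP.
by rewrite (negbTE u0).
Qed.

(** The wedge product and the rows form a frame, of determinant [|wedge A| ^ 2];
the first coordinate of [u] in it is proportional to its dot product with
[wedge A]. *)
Lemma wedge_orth_span (u : 'rV[R]_m.+1) : wedge A != 0 ->
  dotv u (wedge A) = 0 -> exists c : 'rV[R]_m, u = c *m A.
Proof.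
move=> w0 uw.
have hd : \det (col_mx (wedge A) A : 'M[R]_(1 + m)) != 0.
  rewrite -dotv_wedge; apply/eqP => /dotv_eq0 /eqP.
  by rewrite (negbTE w0).
have hu : (col_mx (wedge A) A : 'M[R]_(1 + m)) \in unitmx.
  by rewrite unitmxE unitfE.
pose t : 'rV[R]_(1 + m) := u *m invmx (col_mx (wedge A) A : 'M[R]_(1 + m)).
have uE : u = lsubmx t *m wedge A + rsubmx t *m A.
  by rewrite -mul_row_col hsubmxK mulmxKV.
exists (rsubmx t).
suff l0 : lsubmx t = 0 by rewrite {1}uE l0 mul0mx add0r.
move: uw; rewrite uE dotvDl.
have -> : dotv (rsubmx t *m A) (wedge A) = 0.
  rewrite mulmx_sum_row dotv_suml big1 // => i _.
  by rewrite dotvZl wedge_orth mulr0.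
rewrite addr0 [lsubmx t]mx11_scalar mul_scalar_mx dotvZl => /eqP.
rewrite mulf_eq0 => /orP[/eqP ->|/eqP /dotv_eq0 /eqP]; first by rewrite raddf0.
by rewrite (negbTE w0).
Qed.

End Wedge.

(** * Affine functions and combinations *)

Section Continuity.
Variable R : realType.

Lemma cvg_sum_real (X I : Type) (F : set_system X) (r : seq I) (P : pred I)
    (f : I -> X -> R) (l : I -> R) : Filter F ->
  (forall i, P i -> f i x @[x --> F] --> l i) ->
  (\sum_(i <- r | P i) f i x) @[x --> F] --> \sum_(i <- r | P i) l i.
Proof.
move=> FF fl; elim: r => [|i r IH].
  by under eq_fun do rewrite big_nil; rewrite big_nil; exact: cvg_cst.
under eq_fun do rewrite big_cons; rewrite big_cons.
case: ifP => // Pi; apply: cvgD => //; exact: fl.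
Qed.

Lemma affine_continuous m (a : 'rV[R]_m) (b : R) :
  continuous (fun x : 'rV[R]_m => dotv a x + b).
Proof.
move=> x; have FF : Filter (nbhs x) by exact: nbhs_filter.
apply: (@cvgD _ _ _ (nbhs x)); last exact: cvg_cst.
apply: (@cvg_sum_real _ _ (nbhs x)) => i _.
apply: (@cvgM _ _ (nbhs x)); first exact: cvg_cst.
exact: coord_continuous.
Qed.

End Continuity.

Section Combinations.
Variables (R : realType) (m : nat).

Lemma affine_combination (I : Type) (r : seq I) (P : pred I) (c : I -> R)
    (v : I -> 'rV[R]_m) a b :
  \sum_(i <- r | P i) c i = 1 ->
  dotv a (\sum_(i <- r | P i) c i *: v i) + b =
  \sum_(i <- r | P i) c i * (dotv a (v i) + b).
Proof.
move=> c1; rewrite dotv_sumr -[b in LHS]mul1r -c1 mulr_suml -big_split.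
by apply: eq_bigr => i _; rewrite dotvZr mulrDr.
Qed.

(** Hulls weigh the vertices by functions of the global vertex index, barycentric
coordinates are indexed by the local number. With [Q] the sign condition this
translates closed and open simplices and facets alike. *)
Lemma imset_combination (K : finType) p (g : 'I_p -> K) (v : K -> 'rV[R]_m)
    (Q : R -> Prop) x : injective g ->
  (exists c : K -> R, [/\ forall k, k \in [set g l | l : 'I_p]%SET -> Q (c k),
      \sum_(k in [set g l | l : 'I_p]%SET) c k = 1
    & x = \sum_(k in [set g l | l : 'I_p]%SET) c k *: v k]) <->
  (exists b : 'I_p -> R, [/\ forall l, Q (b l), \sum_l b l = 1
    & x = \sum_l b l *: v (g l)]).
Proof.
move=> gI; have gI2 : {in [set: 'I_p]%SET &, injective g} by move=> ? ? _ _ /gI.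
have gI3 : {in 'I_p &, injective g} by move=> ? ? _ _ /gI.
split=> [[c [c0 c1 ->]]|[b [b0 b1 ->]]].
  exists (c \o g); split=> [l||]; first by apply: c0; exact: imset_f.
    by rewrite -[RHS]c1 big_imset.
  by rewrite big_imset.
pose c k := \sum_(l | g l == k) b l.
have cg l : c (g l) = b l.
  rewrite /c (big_pred1 l) // => i; apply/eqP/eqP => [/gI //|-> //].
exists c; split=> [k /imsetP [l _ ->]||]; first by rewrite cg.
  by rewrite big_imset //= -[RHS]b1; apply: eq_bigr => l _; rewrite cg.
by rewrite big_imset //=; apply: eq_bigr => l _; rewrite cg.
Qed.

End Combinations.

(** * Barycentric coordinates of a nondegenerate simplex *)

Section Simplices.
Variables (R : realType) (n : nat) (T : triangulation R n).
Hypothesis hT : polyhedral_surface T.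
Hypothesis A1 : forall j, 0 < simp_measure (T := T) j.

Notation E := 'rV[R]_n.+2.
Notation J := 'I_(nsimp T).
Notation K := 'I_(nvert T).
Implicit Types (j : J) (k : K) (x y : E).

Let edge j : 'M[R]_(n.+1, n.+2) := edges (simp_pt j).
Let normal j : E := wedge (edge j).

Lemma gram_edges_neq0 j : \det (edges (simp_pt j) *m (edges (simp_pt j))^T) != 0.
Proof.
apply/eqP => d0; have := A1 j.
by rewrite /simp_measure /simplex_measure /Defs.jacobian d0 sqrtr0 mul0r ltxx.
Qed.

Lemma normal_neq0 j : normal j != 0.
Proof. exact/wedge_neq0/gram_edges_neq0. Qed.

Lemma enorm_normal_gt0 j : 0 < enorm (normal j).
Proof.
rewrite sqrtr_gt0 lt_def dotv_ge0 andbT.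
by apply/eqP => /dotv_eq0 /eqP; rewrite (negbTE (normal_neq0 j)).
Qed.

Lemma nu_unit j : dotv (nu j) (nu j) = 1.
Proof.
have h := enorm_normal_gt0 j.
rewrite /nu dotvZl dotvZr -[dotv _ _]sqr_sqrtr ?dotv_ge0 //.
rewrite -/(enorm (normal j)) expr2; field.
by rewrite gt_eqF.
Qed.

Lemma nu_orthE j x : (dotv x (nu j) = 0) <-> (dotv x (normal j) = 0).
Proof.
rewrite dotvZr; split=> [/eqP|->]; last by rewrite mulr0.
by rewrite mulf_eq0 invr_eq0 (gt_eqF (enorm_normal_gt0 j)) => /eqP.
Qed.

Lemma edge_rowE j a : row a (edge j) = simp_pt j (lift ord0 a) - simp_pt j ord0.
Proof. by rewrite rowK. Qed.

Lemma nu_edge j l : dotv (simp_pt j l - simp_pt j ord0) (nu j) = 0.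
Proof.
apply/nu_orthE; case: (unliftP ord0 l) => [a ->|->]; last first.
  by rewrite subrr dotv0l.
by rewrite -edge_rowE wedge_orth.
Qed.


(* Columns of the inverse of the frame made of the normal and the edges: this is
   the basis dual to the edges, extended by zero along the normal. *)
Let frame j : 'M[R]_(1 + n.+1) := col_mx (normal j) (edge j).

Let dual j (a : 'I_n.+1) : E := (col (rshift 1 a) (invmx (frame j)))^T.

Let dualE j a x : dotv (dual j a) x = (x *m invmx (frame j)) 0 (rshift 1 a).
Proof. by rewrite mxE; apply: eq_bigr => i _; rewrite !mxE mulrC. Qed.

Let dual_edge j a b : dotv (dual j a) (row b (edge j)) = (a == b)%:R.
Proof.
have hu : frame j \in unitmx.
  rewrite unitmxE unitfE -dotv_wedge; apply/eqP => /dotv_eq0 /eqP.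
  by rewrite (negbTE (normal_neq0 j)).
have -> : row b (edge j) = row (rshift 1 b) (frame j).
  by apply/rowP => i; rewrite [LHS]mxE [RHS]mxE col_mxEd.
by rewrite dualE -row_mul mulmxV // !mxE eq_rshift eq_sym.
Qed.

(** The coordinates sum to one, which determines the gradient at the base
vertex from the others. *)
Definition bgrad j (i : 'I_n.+2) : E :=
  if unlift ord0 i is Some a then dual j a else - \sum_a dual j a.

(** Affine on the whole space and constant along the normal. *)
Definition bary j (i : 'I_n.+2) x : R :=
  dotv (bgrad j i) (x - simp_pt j ord0) + (i == ord0)%:R.

Lemma baryE j i : exists b, forall x, bary j i x = dotv (bgrad j i) x + b.
Proof.
exists ((i == ord0)%:R - dotv (bgrad j i) (simp_pt j ord0)) => x.
by rewrite /bary dotvBr; ring.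
Qed.

Let bary0E j x :
  bary j ord0 x = 1 - \sum_a dotv (dual j a) (x - simp_pt j ord0).
Proof.
by rewrite /bary /bgrad unlift_none eqxx dotvNl dotv_suml addrC.
Qed.

Let baryS j x a :
  bary j (lift ord0 a) x = dotv (dual j a) (x - simp_pt j ord0).
Proof. by rewrite /bary /bgrad liftK addr0. Qed.

Lemma bary_sum j x : \sum_i bary j i x = 1.
Proof.
by rewrite big_ord_recl (eq_bigr _ (fun a _ => baryS j x a)) bary0E subrK.
Qed.

(** In the hyperplane of the simplex the edges span all directions, by
[wedge_orth_span]. *)
Lemma bary_expand j x : dotv (x - simp_pt j ord0) (nu j) = 0 ->
  x = \sum_i bary j i x *: simp_pt j i.
Proof.
move=> /nu_orthE xN.
have [c cE] := wedge_orth_span (A := edge j) (normal_neq0 j) xN.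
rewrite big_ord_recl bary0E.
have dc a : dotv (dual j a) (x - simp_pt j ord0) = c 0 a.
  rewrite cE mulmx_sum_row dotv_sumr (bigD1 a) //= big1.
    by rewrite dotvZr dual_edge eqxx mulr1 addr0.
  by move=> b ba; rewrite dotvZr dual_edge eq_sym (negbTE ba) mulr0.
rewrite -[LHS](subrK (simp_pt j ord0)) {1}cE mulmx_sum_row.
rewrite (eq_bigr _ (fun a _ => dc a)).
under [X in _ = _ + X]eq_bigr do rewrite baryS dc.
under [X in X + _ = _]eq_bigr do rewrite edge_rowE scalerBr.
rewrite sumrB -scaler_suml scalerBl scale1r.
by rewrite -addrA [- _ + _]addrC addrC.
Qed.

Lemma bary_vertex j i l : bary j i (simp_pt j l) = (i == l)%:R.
Proof.
case: (unliftP ord0 l) => [b|] ->.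
  have e a : dotv (dual j a) (simp_pt j (lift ord0 b) - simp_pt j ord0)
    = (a == b)%:R by rewrite -edge_rowE dual_edge.
  case: (unliftP ord0 i) => [a|] ->.
    by rewrite baryS e (inj_eq lift_inj).
  rewrite bary0E (bigD1 b) //= big1 => [|a ab]; rewrite e ?(negbTE ab) //.
  by rewrite eqxx addr0 subrr.
rewrite /bary subrr dotv0r add0r.
by [].
Qed.

Lemma bary_combination j (b : 'I_n.+2 -> R) i : \sum_l b l = 1 ->
  bary j i (\sum_l b l *: simp_pt j l) = b i.
Proof.
move=> b1; have [c cE] := baryE j i.
rewrite cE affine_combination // (bigD1 i) //= big1 => [|l li].
  by rewrite -cE bary_vertex eqxx mulr1 addr0.
by rewrite -cE bary_vertex eq_sym (negbTE li) mulr0.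
Qed.

Let plane_combination j (b : 'I_n.+2 -> R) : \sum_l b l = 1 ->
  dotv (\sum_l b l *: simp_pt j l - simp_pt j ord0) (nu j) = 0.
Proof.
move=> b1; have -> : \sum_l b l *: simp_pt j l - simp_pt j ord0 =
    \sum_l b l *: (simp_pt j l - simp_pt j ord0).
  under [RHS]eq_bigr do rewrite scalerBr.
  by rewrite sumrB -scaler_suml b1 scale1r.
by rewrite dotv_suml big1 // => l _; rewrite dotvZl nu_edge mulr0.
Qed.

Let simplexP (Q : R -> Prop) j x :
  (exists c : K -> R, [/\ forall k, k \in simp_verts j -> Q (c k),
      \sum_(k in simp_verts j) c k = 1
    & x = \sum_(k in simp_verts j) c k *: vertex k]) <->
  (dotv (x - simp_pt j ord0) (nu j) = 0 /\ forall i, Q (bary j i x)).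
Proof.
rewrite imset_combination; last exact: (simp_inj hT).
split=> [[b [b0 b1 ->]]|[x0 bx]].
  split; first exact: plane_combination.
  by move=> i; rewrite bary_combination.
exists (bary j ^~ x); split=> //; first exact: bary_sum.
exact: bary_expand.
Qed.

(** Affine equations and inequalities: they make the closed simplex topologically
closed, and let a point of the open simplex move in every tangential
direction. *)
Lemma csimplexP j x : csimplex j x <->
  (dotv (x - simp_pt j ord0) (nu j) = 0 /\ forall i, 0 <= bary j i x).
Proof. exact: (simplexP (fun c => 0 <= c)). Qed.

Lemma osimplexP j x : osimplex j x <->
  (dotv (x - simp_pt j ord0) (nu j) = 0 /\ forall i, 0 < bary j i x).
Proof. exact: (simplexP (fun c => 0 < c)). Qed.

Lemma osimplexW j x : osimplex j x -> csimplex j x.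
Proof.
by move=> /osimplexP [x0 bx]; apply/csimplexP; split=> // i; exact: ltW.
Qed.

Lemma simplex_expand j x : csimplex j x -> x = \sum_i bary j i x *: simp_pt j i.
Proof. by move=> /csimplexP [x0 _]; exact: bary_expand. Qed.

Lemma simp_pt_csimplex j l : csimplex j (simp_pt j l).
Proof.
apply/csimplexP; split; first exact: nu_edge.
by move=> i; rewrite bary_vertex.
Qed.

Lemma osimplex_combination j (b : 'I_n.+2 -> R) :
  (forall l, 0 < b l) -> \sum_l b l = 1 ->
  osimplex j (\sum_l b l *: simp_pt j l).
Proof.
move=> b0 b1; apply/osimplexP; split; first exact: plane_combination.
by move=> i; rewrite bary_combination.
Qed.

Lemma csimplex_closed j : closed (csimplex j).
Proof.
have -> : csimplex j =
    [set x | dotv (nu j) x + - dotv (simp_pt j ord0) (nu j) = 0] `&`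
    \bigcap_(i in [set: 'I_n.+2]) [set x | 0 <= bary j i x].
  apply/seteqP; split=> x /=.
    move=> /csimplexP [x0 bx]; split=> /=; last by move=> i _ /=.
    by rewrite -[RHS]x0 dotvBl dotvC.
  move=> [x0 bx]; apply/csimplexP; split; last by move=> i; exact: (bx i).
  by rewrite -[RHS]x0 dotvBl dotvC.
apply: closedI.
  apply: (@closed_comp _ _ _ [set y : R | y = 0]); last exact: closed_eq.
  by move=> x _; exact: affine_continuous.
apply: closed_bigI => i _; have [b bE] := baryE j i.
have -> : [set x | 0 <= bary j i x] =
    (fun x => dotv (bgrad j i) x + b) @^-1` [set y | 0 <= y].
  by apply/seteqP; split=> x /=; rewrite bE.
apply: closed_comp; last exact: closed_ge.
by move=> x _; exact: affine_continuous.
Qed.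

End Simplices.

(** * Nodal interpolation *)

Section Interpolation.
Variables (R : realType) (n : nat) (T : triangulation R n).
Hypothesis hT : polyhedral_surface T.
Hypothesis A1 : forall j, 0 < simp_measure (T := T) j.

Notation E := 'rV[R]_n.+2.
Notation J := 'I_(nsimp T).
Notation K := 'I_(nvert T).
Implicit Types (j : J) (k : K) (x y : E) (u : 'cV[R]_(nvert T)).

Lemma vertex_hull (S : {set K}) k : k \in S -> hull S (vertex k).
Proof.
move=> kS; exists (fun i => (i == k)%:R); split=> [i _||].
- exact: ler0n.
- rewrite (bigD1 k) //= eqxx big1 ?addr0 // => i /andP[_ ik].
  by rewrite (negbTE ik).
- rewrite (bigD1 k) //= eqxx big1 ?addr0 ?scale1r // => i /andP[_ ik].
  by rewrite (negbTE ik) scale0r.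
Qed.

(** Extended to the whole space by the affine barycentric coordinates. *)
Definition local_interp u j x : R := \sum_i u (simp j i) 0 * bary j i x.

Definition local_grad u j : E := \sum_i u (simp j i) 0 *: bgrad j i.

Lemma local_interpE u j : exists b, forall x, local_interp u j x = dotv (local_grad u j) x + b.
Proof.
pose b i := projT1 (cid (baryE j i)).
have bE i x : bary j i x = dotv (bgrad j i) x + b i.
  exact: (projT2 (cid (baryE j i))).
exists (\sum_i u (simp j i) 0 * b i) => x.
rewrite /local_interp /local_grad dotv_suml -big_split; apply: eq_bigr => i _ /=.
by rewrite bE dotvZl mulrDr.
Qed.

Lemma local_interp_pt u j l : local_interp u j (simp_pt j l) = u (simp j l) 0.
Proof.
rewrite /local_interp (bigD1 l) //= bary_vertex // eqxx mulr1 big1 ?addr0 // => i il.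
by rewrite bary_vertex // (negbTE il) mulr0.
Qed.

Lemma local_interp_vertex u j k : k \in simp_verts j -> local_interp u j (vertex k) = u k 0.
Proof. by move=> /imsetP [l _ ->]; exact: local_interp_pt. Qed.

(** An affine function commutes with combinations of weight one. *)
Lemma local_interp_combination u j (S : {set K}) (c : K -> R) :
  S \subset simp_verts j -> \sum_(k in S) c k = 1 ->
  local_interp u j (\sum_(k in S) c k *: vertex k) = \sum_(k in S) c k * u k 0.
Proof.
move=> /fintype.subsetP Sj c1; have [b bE] := local_interpE u j.
rewrite bE affine_combination //; apply: eq_bigr => k kS.
by rewrite -bE local_interp_vertex // Sj.
Qed.

(** Two simplices meet in the hull of their common vertices, where both local
interpolants are the same combination of the same nodal values. *)
Lemma local_interp_agree u i j x : csimplex i x -> csimplex j x ->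
  local_interp u i x = local_interp u j x.
Proof.
move=> ix jx; have : (csimplex i `&` csimplex j) x by [].
rewrite (simp_conforming hT) => -[c [_ c1 ->]].
by rewrite !local_interp_combination // (finset.subsetIl, finset.subsetIr).
Qed.

(** The picked simplex does not matter, by [local_interp_agree]. *)
Definition interp u x : R :=
  if [pick j | `[< csimplex (T := T) j x >]] is Some j then local_interp u j x else 0.

Lemma interpE u j x : csimplex j x -> interp u x = local_interp u j x.
Proof.
move=> jx; rewrite /interp; case: pickP => [i /asboolP ix|/(_ j)].
  exact: local_interp_agree.
by move/asboolP.
Qed.

Lemma interp_out u x : ~ Gam T x -> interp u x = 0.
Proof.
move=> xG; rewrite /interp; case: pickP => // i /asboolP ix.
by case: xG; exists i.
Qed.

Lemma simp_pt_mem j l : simp j l \in simp_verts j.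
Proof. exact: imset_f. Qed.

(** A simplex having [k] among its vertices meets [j] in the hull of the common
vertices. If [k] is not one of them, the nodal basis function of [k] vanishes on
that hull, although it is 1 at [vertex k]. *)
Lemma csimplex_vertex j k : csimplex j (vertex k) <-> k \in simp_verts j.
Proof.
split=> [jk|]; last exact: vertex_hull.
have [i ki] := vertex_used hT k.
have : (csimplex i `&` csimplex j) (vertex k) by split=> //; exact: vertex_hull.
rewrite (simp_conforming hT) => -[c [_ c1 kE]].
apply: contraT => kj.
have := local_interp_vertex (delta_mx k 0) ki; rewrite kE local_interp_combination //; last first.
  exact: finset.subsetIl.
rewrite mxE !eqxx big1 => [/eqP|q]; first by rewrite eq_sym oner_eq0.
rewrite finset.in_setI => /andP[_ qj]; rewrite mxE.
by case: eqP => [qk|_]; [rewrite -qk qj in kj|rewrite mulr0].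
Qed.

Definition nodal (f : E -> R) : 'cV[R]_(nvert T) := \col_k f (vertex k).

Lemma interp_vertex u k : interp u (vertex k) = u k 0.
Proof.
have [i ki] := vertex_used hT k.
by rewrite (interpE _ (proj2 (csimplex_vertex i k) ki)) local_interp_vertex.
Qed.

Lemma interpK u : nodal (interp u) = u.
Proof. by apply/colP => k; rewrite mxE interp_vertex. Qed.

Lemma V_local_interpE f j x : V T f -> csimplex j x -> f x = local_interp (nodal f) j x.
Proof.
move=> [_ /(_ j) [a [b fE]] _] jx; rewrite (fE _ jx).
rewrite {1}(simplex_expand hT A1 jx) affine_combination; last exact: bary_sum.
apply: eq_bigr => i _; rewrite mulrC mxE fE //.
exact: (simp_pt_csimplex hT A1).
Qed.

Lemma nodalK f : V T f -> interp (nodal f) = f.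
Proof.
move=> fV; apply/funext => x; case: (pselect (Gam T x)) => [[j _ jx]|xG].
  by rewrite (interpE _ jx) (V_local_interpE fV jx).
by rewrite interp_out //; case: fV => _ _ ->.
Qed.

Lemma GamE : Gam T = \big[setU/set0]_(j <- index_enum J) csimplex j.
Proof.
apply/seteqP; split=> [x [j _ jx]|x].
  by rewrite -bigcup_seq; exists j => //=; rewrite mem_index_enum.
by rewrite -bigcup_seq => -[j _ jx]; exists j.
Qed.

Lemma V_interp u : V T (interp u).
Proof.
split=> [|j|x]; last exact: interp_out.
  rewrite GamE; elim: (index_enum _) => [|j s IH].
    by rewrite big_nil; apply: continuous_subspace0.
  rewrite big_cons; apply: withinU_continuous => //.
  - exact: csimplex_closed.
  - by apply: closed_bigsetU => i _; exact: csimplex_closed.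
  have [b bE] := local_interpE u j.
  apply: (@subspace_eq_continuous _ _ _ (fun x => dotv (local_grad u j) x + b)).
    by move=> x /set_mem jx; rewrite -bE -(interpE u jx).
  apply: continuous_subspaceT; exact: affine_continuous.
have [b bE] := local_interpE u j.
by exists (local_grad u j), b => x jx; rewrite (interpE _ jx) bE.
Qed.

Lemma facet_hull_sub F : hull (facet_verts F) `<=` csimplex (T := T) F.1.
Proof.
move=> x [c [c0 c1 xE]].
have s : facet_verts F \subset simp_verts F.1.
  by apply/fintype.subsetP => k /imsetP [l _ ->]; exact: simp_pt_mem.
exists (fun k => if k \in facet_verts F then c k else 0); split.
- by move=> k _; case: ifP => // /c0.
- rewrite -big_mkcondr /= -[RHS]c1; apply: eq_bigl => k.
  by rewrite andb_idl // => /(fintype.subsetP s).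
- rewrite xE [RHS](bigID (mem (facet_verts F))) /= [X in _ + X]big1 ?addr0.
    apply: eq_big => k; first by rewrite andb_idl // => /(fintype.subsetP s).
    by move=> ->.
  by move=> k /andP[_ /negbTE ->]; rewrite scale0r.
Qed.

(** On a facet the interpolant is a combination of the values at the vertices of
the facet, so boundary conditions can be imposed on nodal values. *)
Lemma interp_vanish u (B : {set J * 'I_n.+2}) x :
  (forall k, facets_union B (vertex k) -> u k 0 = 0) ->
  facets_union B x -> interp u x = 0.
Proof.
move=> u0 [F FB Fx]; rewrite (interpE _ (facet_hull_sub Fx)).
have s : facet_verts F \subset simp_verts F.1.
  by apply/fintype.subsetP => k /imsetP [l _ ->]; exact: simp_pt_mem.
case: Fx => c [c0 c1 ->]; rewrite local_interp_combination // big1 // => k kF.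
by rewrite u0 ?mulr0 //; exists F => //; exact: vertex_hull.
Qed.

Lemma V0_interp u : (forall k, bd T (vertex k) -> u k 0 = 0) -> V0 T (interp u).
Proof.
by move=> u0; split; [exact: V_interp|move=> x; exact: interp_vanish].
Qed.

Lemma V1_interp u : (forall k, bd1 T (vertex k) -> u k 0 = 0) -> V1 T (interp u).
Proof.
by move=> u0; split; [exact: V_interp|move=> x; exact: interp_vanish].
Qed.

Lemma bd1_sub : bd1 T `<=` bd T.
Proof.
move=> x [F FB Fx]; exists F => //=; rewrite -(bd_cover hT).
by rewrite finset.in_setU; apply/orP; left.
Qed.

End Interpolation.

(** * Surface gradients *)

Section Local_values.
Variables (R : realType) (n : nat) (T : triangulation R n).
Hypothesis hT : polyhedral_surface T.
Hypothesis A1 : forall j, 0 < simp_measure (T := T) j.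

Notation E := 'rV[R]_n.+2.
Notation J := 'I_(nsimp T).
Notation K := 'I_(nvert T).
Implicit Types (j : J) (k : K) (x y : E) (u : 'cV[R]_(nvert T)).

Lemma Pmx_tr j : (Pmx j)^T = Pmx j.
Proof. by rewrite /Pmx linearB /= trmx1 trmx_mul trmxK. Qed.

Lemma Pmx_nu j : Pmx j *m (nu j)^T = 0.
Proof.
rewrite mulmxBl mul1mx -mulmxA [nu j *m _]mx11_scalar -dotvE (nu_unit A1).
by rewrite mulmx1 subrr.
Qed.

Lemma row_Pmx_nu j i : dotv (row i (Pmx j)) (nu j) = 0.
Proof. by rewrite dotvE -row_mul Pmx_nu !mxE. Qed.

(** Positivity of the barycentric coordinates is an open condition. *)
Lemma near_csimplex j x (v : E) : osimplex j x -> dotv v (nu j) = 0 ->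
  \forall h \near (0 : R), csimplex j (h *: v + x).
Proof.
move=> /(osimplexP hT A1) [x0 bx] v0.
have nearb i : \forall h \near (0 : R), 0 <= bary j i (h *: v + x).
  have [b bE] := baryE j i.
  have : (h * dotv (bgrad j i) v + bary j i x) @[h --> (0 : R)] -->
      0 * dotv (bgrad j i) v + bary j i x.
    apply: cvgD; last exact: cvg_cst.
    by apply: cvgM; [exact: cvg_id|exact: cvg_cst].
  rewrite mul0r add0r => /cvgr_gt /(_ 0 (bx i)).
  by apply: filterS => h /ltW; rewrite !bE dotvDr dotvZr addrA.
have := filter_forall (nbhs_filter (0 : R)) nearb.
apply: filterS => h hb; apply/(csimplexP hT A1); split=> //.
by rewrite -addrA dotvDl x0 dotvZl v0 mulr0 addr0.
Qed.

(** A finite element function is affine only on the closed simplex and vanishes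
off the surface; tangential steps from an interior point stay in the simplex, so
its tangential derivatives are nevertheless those of the affine function. *)
Lemma derive_on_simplex j (f : E -> R) a b x (v : E) :
  (forall y, csimplex j y -> f y = dotv a y + b) ->
  osimplex j x -> dotv v (nu j) = 0 -> 'D_v f x = dotv a v.
Proof.
move=> fE jx v0; apply: cvg_lim => //; apply: cvg_near_cst.
near=> h.
have h0 : h != 0 by near: h; exact: nbhs_dnbhs_neq.
rewrite /= !fE; last first.
- by near: h; apply: nbhs_dnbhs; exact: near_csimplex.
- exact: osimplexW.
rewrite dotvDr dotvZr; change (h^-1 * (h * dotv a v + dotv a x + b - (dotv a x + b)) = dotv a v).
by field.
Unshelve. all: by end_near.
Qed.

Lemma sgrad_affine j (f : E -> R) a b x :
  (forall y, csimplex j y -> f y = dotv a y + b) ->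
  osimplex j x -> sgrad f j x = a *m Pmx j.
Proof.
move=> fE jx; apply/rowP => i.
rewrite mxE (derive_on_simplex fE jx (row_Pmx_nu j i)).
by rewrite -[in RHS]Pmx_tr !mxE; apply: eq_bigr => k _; rewrite !mxE.
Qed.

Definition grad u j : E := local_grad u j *m Pmx j.

Definition gradv (U : 'M[R]_(nvert T, n.+2)) j : 'M[R]_n.+2 :=
  \matrix_i grad (col i U) j.

Definition nodalv (f : E -> E) : 'M[R]_(nvert T, n.+2) := \matrix_k f (vertex k).

Lemma col_nodalv f i : col i (nodalv f) = nodal T (fun x => f x 0 i).
Proof. by apply/colP => k; rewrite !mxE. Qed.

Lemma row_nodalv f k : row k (nodalv f) = f (vertex k).
Proof. by rewrite rowK. Qed.

Lemma V_affine f j : V T f ->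
  exists b, forall y, csimplex j y -> f y = dotv (local_grad (nodal T f) j) y + b.
Proof.
move=> fV; have [b bE] := local_interpE (nodal T f) j.
by exists b => y jy; rewrite (V_local_interpE hT A1 fV jy) bE.
Qed.

Lemma sgrad_V f j x : V T f -> osimplex j x -> sgrad f j x = grad (nodal T f) j.
Proof. by move=> /(V_affine j) [b fE] jx; exact: (sgrad_affine fE). Qed.

Lemma sgradv_V f j x : vec (V T) f -> osimplex j x ->
  sgradv f j x = gradv (nodalv f) j.
Proof.
by move=> fV jx; apply/row_matrixP => i; rewrite !rowK col_nodalv sgrad_V.
Qed.

Lemma sgradv_idD f j x c : vec (V T) f -> osimplex j x ->
  sgradv (fun y => y + c *: f y) j x = Pmx j + c *: gradv (nodalv f) j.
Proof.
move=> fV jx; apply/row_matrixP => i.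
have [b fE] := V_affine j (fV i).
rewrite rowK (@sgrad_affine j _
  (delta_mx 0 i + c *: local_grad (nodal T (fun y => f y 0 i)) j) (c * b)) //.
  by rewrite mulmxDl -scalemxAl -rowE [RHS]linearD [X in _ = _ + X]linearZ /= rowK col_nodalv.
move=> y jy; rewrite !mxE fE // dotvDl dotvZl dotv_deltal; ring.
Qed.

Lemma sgradv_id j x : osimplex j x -> sgradv id j x = Pmx j.
Proof.
move=> jx; apply/row_matrixP => i.
rewrite rowK (@sgrad_affine j _ (delta_mx 0 i) 0) // -?rowE //.
by move=> y _; rewrite dotv_deltal addr0.
Qed.

(** * One-sided values at the vertices *)

(** The segment to the barycenter runs inside and ends at the vertex. Hence the
limits in the lumped product are along a proper filter, and unique. *)
Lemma closure_osimplex j l : closure (osimplex j) (simp_pt j l).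
Proof.
pose N := (n.+2%:R : R); have N0 : N != 0 by rewrite pnatr_eq0.
pose c := \sum_i N^-1 *: simp_pt j i.
have inside t : 0 < t -> t < 1 ->
    osimplex j (simp_pt j l + t *: (c - simp_pt j l)).
  move=> t0 t1.
  have -> : simp_pt j l + t *: (c - simp_pt j l) =
      \sum_i ((1 - t) * (i == l)%:R + t / N) *: simp_pt j i.
    under eq_bigr do rewrite scalerDl -!scalerA.
    rewrite big_split /= -!scaler_sumr (bigD1 l) //= eqxx scale1r big1.
      by rewrite addr0 scalerBl scale1r scalerBr /c -scaler_sumr addrA addrAC.
    by move=> i /negbTE ->; rewrite scale0r.
  apply: (osimplex_combination hT A1) => [i|].
    rewrite ltr_wpDl ?mulr_ge0 ?ler0n ?subr_ge0 ?(ltW t1) //.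
    by rewrite divr_gt0 // ltr0n.
  rewrite big_split /= -mulr_sumr (bigD1 l) //= eqxx big1 => [|i /negbTE -> //].
  rewrite sumr_const card_ord -(mulr_natr (t / N)) -/N.
  by rewrite divfK // addr0 !mulr1 subrK.
move=> B nB.
have : (simp_pt j l + t *: (c - simp_pt j l)) @[t --> (0 : R)] --> simp_pt j l.
  rewrite -[X in _ --> X]addr0 -(scale0r (c - simp_pt j l)).
  apply: cvgD; first exact: cvg_cst.
  by apply: cvgZ; [exact: cvg_id|exact: cvg_cst].
move=> /(_ B nB) nearB.
have : \forall t \near (0 : R)^'+, B (simp_pt j l + t *: (c - simp_pt j l)) /\ (0 < t /\ t < 1).
  near=> t; split; last by split; near: t; [exact: nbhs_right_gt|exact: nbhs_right_lt].
  by near: t; apply: cvg_within; exact: nearB.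
move=> /filter_ex [t [Bt [t0 t1]]].
by exists (simp_pt j l + t *: (c - simp_pt j l)); split=> //; exact: inside.
Unshelve. all: by end_near.
Qed.

Definition tends j l (h : E -> R) (c : R) : Prop :=
  h x @[x --> within (osimplex j) (nbhs (simp_pt j l))] --> c.

(** Entrywise, so that only real limits are ever computed. *)
Definition tendsm p q j l (h : E -> 'M[R]_(p, q)) (c : 'M[R]_(p, q)) : Prop :=
  forall a b, tends j l (fun x => h x a b) (c a b).

Section Tends.
Variables (j : J) (l : 'I_n.+2).
Let F := within (osimplex j) (nbhs (simp_pt j l)).
Let FF : Filter F. Proof. exact: within_filter. Qed.

Lemma tends_lim h c : tends j l h c -> lim (h x @[x --> F]) = c.
Proof.
have := within_nbhs_proper (@closure_osimplex j l).
by move=> PF hc; apply: cvg_lim.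
Qed.

Lemma tends_eq h c : (forall x, osimplex j x -> h x = c) -> tends j l h c.
Proof.
move=> hE; apply: cvg_near_cst; apply: (@filterS _ (nbhs (simp_pt j l)) _ setT).
  by move=> x _ jx; exact: hE.
exact: filterT.
Qed.

Lemma tends_cst (c : R) : tends j l (fun=> c) c.
Proof. exact: tends_eq. Qed.

Lemma tendsD h g c d : tends j l h c -> tends j l g d ->
  tends j l (fun x => h x + g x) (c + d).
Proof. by move=> hc gd; exact: (cvgD hc gd). Qed.

Lemma tendsM h g c d : tends j l h c -> tends j l g d ->
  tends j l (fun x => h x * g x) (c * d).
Proof. by move=> hc gd; exact: (cvgM hc gd). Qed.

Lemma tendsB h g c d : tends j l h c -> tends j l g d ->
  tends j l (fun x => h x - g x) (c - d).
Proof. by move=> hc gd; exact: (cvgB hc gd). Qed.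

Lemma tends_sum (I : Type) (r : seq I) (P : pred I) (h : I -> E -> R) c :
  (forall i, tends j l (h i) (c i)) ->
  tends j l (fun x => \sum_(i <- r | P i) h i x) (\sum_(i <- r | P i) c i).
Proof. by move=> hc; apply: (@cvg_sum_real _ _ _ F) => i _; exact: hc. Qed.

(** On the simplex the function agrees with an affine one, which is continuous on
the whole space. *)
Lemma tends_V f : V T f -> tends j l f (f (simp_pt j l)).
Proof.
move=> /(V_affine j) [b fE].
rewrite /tends fE; last exact: (simp_pt_csimplex hT A1).
set a := local_grad _ _ in fE *.
have cont : (dotv a x + b) @[x --> F] --> dotv a (simp_pt j l) + b.
  apply: cvg_trans (@affine_continuous R n.+2 a b (simp_pt j l)).
  by apply: cvg_app; exact: cvg_within.
apply: cvg_trans cont; apply: near_eq_cvg.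
apply: (@filterS _ (nbhs (simp_pt j l)) _ setT); last exact: filterT.
by move=> x _ jx; rewrite fE //; exact: osimplexW.
Qed.

Lemma tendsm_cst p q (c : 'M[R]_(p, q)) : tendsm j l (fun=> c) c.
Proof. by move=> a b; exact: tends_cst. Qed.

Lemma tendsm_eq p q h (c : 'M[R]_(p, q)) :
  (forall x, osimplex j x -> h x = c) -> tendsm j l h c.
Proof. by move=> hE a b; apply: tends_eq => x /hE ->. Qed.

Lemma tendsm_V f : vec (V T) f -> tendsm j l f (f (simp_pt j l)).
Proof.
by move=> fV a b; rewrite (ord1 a); exact: (tends_V (fV b)).
Qed.

Lemma tendsmD p q h g (c d : 'M[R]_(p, q)) : tendsm j l h c ->
  tendsm j l g d -> tendsm j l (fun x => h x + g x) (c + d).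
Proof.
move=> hc gd a b; rewrite mxE; under eq_fun do rewrite mxE.
exact: tendsD.
Qed.

Lemma tendsmZ p q (s : E -> R) r h (c : 'M[R]_(p, q)) : tends j l s r ->
  tendsm j l h c -> tendsm j l (fun x => s x *: h x) (r *: c).
Proof.
move=> sr hc a b; rewrite mxE; under eq_fun do rewrite mxE.
exact: tendsM.
Qed.

Lemma tendsm_tr p q h (c : 'M[R]_(p, q)) : tendsm j l h c ->
  tendsm j l (fun x => (h x)^T) c^T.
Proof. by move=> hc a b; rewrite mxE; under eq_fun do rewrite mxE; exact: hc. Qed.

Lemma tendsm_mul p q r h g (c : 'M[R]_(p, q)) (d : 'M[R]_(q, r)) :
  tendsm j l h c -> tendsm j l g d ->
  tendsm j l (fun x => h x *m g x) (c *m d).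
Proof.
move=> hc gd a b; rewrite mxE; under eq_fun do rewrite mxE.
by apply: tends_sum => i; exact: tendsM.
Qed.

Lemma tends_dotv m h g (c d : 'rV[R]_m) : tendsm j l h c -> tendsm j l g d ->
  tends j l (fun x => dotv (h x) (g x)) (dotv c d).
Proof. by move=> hc gd; apply: tends_sum => i; exact: tendsM. Qed.

Lemma tends_frob m h g (c d : 'M[R]_m) : tendsm j l h c -> tendsm j l g d ->
  tends j l (fun x => frob (h x) (g x)) (frob c d).
Proof.
move=> hc gd; apply: tends_sum => i.
by apply: (tendsm_mul _ gd); exact: tendsm_tr.
Qed.

End Tends.

(** The vertex quadrature, applied to the values of an integrand at the vertices. *)
Definition lump (H : J -> 'I_n.+2 -> R) : R :=
  (n.+2%:R)^-1 * \sum_j simp_measure j * \sum_l H j l.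

Lemma lumpedE (h : J -> E -> R) H : (forall j l, tends j l (h j) (H j l)) ->
  lumped h = lump H.
Proof.
move=> hH; congr (_ * _); apply: eq_bigr => j _; congr (_ * _).
by apply: eq_bigr => l _; apply: tends_lim.
Qed.

End Local_values.

(** * Integrals over simplices *)

Section Reference_integrals.
Variable R : realType.

Lemma integral_power (c r : R) m : 0 < r ->
  \int[lebesgue_measure]_(x in `]0, r[) (c * (r - x) ^+ m) =
  c * r ^+ m.+1 / m.+1%:R.
Proof.
move=> r0; pose f (x : R) := c * (r - x) ^+ m.
pose F (x : R) := - (c / m.+1%:R) * (r - x) ^+ m.+1.
have dF (x : R) : is_derive x 1 F (f x).
  have dg : is_derive x (1 : R) (fun y : R => r - y) (- 1).
    by rewrite -[- 1]add0r; apply: is_deriveB.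
  have -> : F = - (c / m.+1%:R) *: (fun y : R => r - y) ^+ m.+1.
    by apply/funext => y; rewrite /F exprfctE.
  apply: is_derive_eq.
  rewrite /f /GRing.scale /= -mulr_natr.
  by field; rewrite addrC natr1 pnatr_eq0.
have cf : continuous f.
  move=> x; apply: cvgM; first exact: cvg_cst.
  apply: (@cvg_comp _ _ _ _ (fun y : R => y ^+ m)); last exact: exprn_continuous.
  by apply: cvgB; [exact: cvg_cst|exact: cvg_id].
have cF : continuous F.
  by move=> x; apply: differentiable_continuous; apply/derivable1_diffP; have [] := dF x.
have intf : lebesgue_measure.-integrable `[0, r] (EFin \o f).
  apply: continuous_compact_integrable; first exact: segment_compact.
  exact: continuous_subspaceT.
rewrite Rintegral_itv_bndo_bndc; last first.
  apply: (integrableS _ _ _ intf) => //.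
  by apply: subset_itv; rewrite bnd_simp.
rewrite Rintegral_itv_obnd_cbnd; last first.
  apply: (integrableS _ _ _ intf) => //.
  by apply: subset_itv; rewrite bnd_simp.
rewrite /Rintegral (@continuous_FTC2 _ f F) //.
- rewrite /F /= subrr expr0n /= subr0 mulr0 add0r; field.
  by rewrite addrC natr1 pnatr_eq0.
- exact: continuous_subspaceT.
- split=> [x _||]; first by have [] := dF x.
  + by apply: cvg_at_right_filter; exact: cF.
  + by apply: cvg_at_left_filter; exact: cF.
- by move=> x _; rewrite derive1E; apply: derive_val.
Qed.

Definition ref_simplex m (r : R) : set 'rV[R]_m :=
  [set t | (forall i, 0 < t 0 i) /\ \sum_i t 0 i < r].

Lemma ref_simplex_row_mx m (r x : R) (s : 'rV[R]_m) : 0 < x ->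
  ref_simplex (r - x) s ->
  ref_simplex r (row_mx (x%:M : 'M[R]_1) s : 'rV[R]_(1 + m)).
Proof.
move=> x0 [s0 sr]; split=> [i|].
  rewrite mxE; case: splitP => k _; last exact: s0.
  by rewrite !mxE (ord1 k) eqxx mulr1n.
rewrite big_split_ord /= big_ord1 row_mxEl mxE eqxx mulr1n.
by under eq_bigr do rewrite row_mxEr; rewrite addrC -ltrBrDr.
Qed.

(** Slicing at the first coordinate [x] leaves a reference simplex of size
[r - x], so the volumes [r ^+ m / m`!] follow by induction on the dimension. *)
Lemma ref_integral_cst m (r c : R) (f : 'rV[R]_m -> R) : 0 < r ->
  (forall t, ref_simplex r t -> f t = c) ->
  ref_integral r f = c * (r ^+ m / m`!%:R).
Proof.
elim: m r f => [|m IH] r f r0 fc /=.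
  rewrite fc; first by rewrite fact0 expr0 divr1 mulr1.
  by split=> [[]//|]; rewrite big_ord0.
transitivity (\int[lebesgue_measure]_(x in `]0, r[) (c / m`!%:R * (r - x) ^+ m)).
  apply: eq_Rintegral => x /set_mem /=; rewrite in_itv /= => /andP[x0 xr].
  rewrite IH ?subr_gt0 //; first by rewrite mulrAC mulrA.
  by move=> s sx; apply: fc; exact: ref_simplex_row_mx.
rewrite integral_power // factS natrM invfM; ring.
Qed.

(** The reference simplex parametrizes the open simplex, where the integrands of
the scheme are known explicitly. *)
Lemma ref_simplex_point m d (v : 'I_m.+1 -> 'rV[R]_d) t : ref_simplex 1 t ->
  exists b : 'I_m.+1 -> R, [/\ forall l, 0 < b l, \sum_l b l = 1
    & v ord0 + t *m edges v = \sum_l b l *: v l].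
Proof.
move=> [t0 t1].
exists (fun l => if unlift ord0 l is Some a then t 0 a else 1 - \sum_a t 0 a).
split.
- by move=> l; case: (unliftP ord0 l) => [a|] _ //; rewrite subr_gt0.
- rewrite big_ord_recl unlift_none; under [X in _ + X]eq_bigr do rewrite liftK.
  by rewrite subrK.
- rewrite big_ord_recl unlift_none.
  under [X in _ = _ + X]eq_bigr do rewrite liftK.
  rewrite mulmx_sum_row; under [X in _ + X = _]eq_bigr do rewrite rowK scalerBr.
  by rewrite sumrB -scaler_suml scalerBl scale1r -!addrA [- _ + _]addrC.
Qed.

Lemma simplex_integral_cst m d (v : 'I_m.+1 -> 'rV[R]_d) h c :
  (forall b : 'I_m.+1 -> R, (forall l, 0 < b l) -> \sum_l b l = 1 ->
    h (\sum_l b l *: v l) = c) ->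
  simplex_integral v h = simplex_measure v * c.
Proof.
move=> hc; rewrite /simplex_integral (@ref_integral_cst _ _ c) ?ltr01 //.
  by rewrite expr1n /simplex_measure; ring.
by move=> t /(ref_simplex_point v) [b [b0 b1 ->]]; exact: hc.
Qed.

(** In dimension at most one the integrand is a function of one variable, so
that continuity on the closed simplex suffices for integrability. *)
Lemma simplex_integral_lin m d (v : 'I_m.+1 -> 'rV[R]_d) (c : R)
    (h1 h2 g1 g2 : 'rV[R]_d -> R) : (m <= 1)%N ->
  continuous g1 -> continuous g2 ->
  (forall b : 'I_m.+1 -> R, (forall l, 0 < b l) -> \sum_l b l = 1 ->
    h1 (\sum_l b l *: v l) = g1 (\sum_l b l *: v l) /\
    h2 (\sum_l b l *: v l) = g2 (\sum_l b l *: v l)) ->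
  simplex_integral v (fun x => c * h1 x + h2 x) =
  c * simplex_integral v h1 + simplex_integral v h2.
Proof.
rewrite /simplex_integral => m1 cg1 cg2 hg.
case: m m1 v hg => [|[|//]] _ v hg; first by rewrite /=; ring.
pose p (x : R) : 'rV[R]_d := v ord0 + x *: row 0 (edges v).
have pE (x : R) : v ord0 + (row_mx (x%:M : 'M[R]_1) (0 : 'rV_0) : 'rV[R]_(1 + 0)) *m edges v = p x.
  rewrite /p; congr (_ + _); rewrite mulmx_sum_row big_ord1; congr (_ *: _).
  have -> : ord0 = lshift 0 (0 : 'I_1) by apply: val_inj.
  by rewrite row_mxEl mxE eqxx mulr1n.
have cp : continuous p.
  move=> x; apply: cvgD; first exact: cvg_cst.
  by apply: cvgZ; [exact: cvg_id|exact: cvg_cst].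
have intg g : continuous g -> lebesgue_measure.-integrable `]0, 1[ (EFin \o (g \o p)).
  move=> cg.
  have I01 : lebesgue_measure.-integrable `[0, 1] (EFin \o (g \o p)).
    apply: continuous_compact_integrable; first exact: segment_compact.
    apply: continuous_subspaceT => x.
    by apply: continuous_comp; [exact: cp|exact: cg].
  apply: (integrableS _ _ _ I01) => //.
  by apply: subset_itv; rewrite bnd_simp.
have hp (x : R) : x \in `]0, 1[%classic -> h1 (p x) = g1 (p x) /\ h2 (p x) = g2 (p x).
  move=> /set_mem /=; rewrite in_itv /= => /andP[x0 x1].
  rewrite -pE; have : ref_simplex 1 (row_mx (x%:M : 'M[R]_1) (0 : 'rV_0) : 'rV[R]_(1 + 0)).
    apply: ref_simplex_row_mx => //; split; first by case.
    by rewrite big_ord0 subr_gt0.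
  by move=> /(ref_simplex_point v) [b [b0 b1 ->]]; exact: hg.
transitivity (Defs.jacobian v * \int[lebesgue_measure]_(x in `]0, 1[)
    (c * g1 (p x) + g2 (p x))).
  congr (_ * _); apply: eq_Rintegral => x xI.
  by rewrite /= pE; have [-> ->] := hp _ xI.
rewrite RintegralD //; last exact: intg; last first.
  apply: (intg (fun x => c * g1 x)) => x; have FF := nbhs_filter x.
  by apply: (@cvgM _ _ (nbhs x)); [exact: cvg_cst|exact: cg1].
rewrite RintegralZl //; last exact: intg.
have -> : \int[lebesgue_measure]_(x in `]0, 1[) g1 (p x) =
    ref_integral 1 (fun t : 'rV_1 => h1 (v ord0 + t *m edges v)).
  by apply: eq_Rintegral => x xI; rewrite /= pE; have [-> _] := hp _ xI.
have -> : \int[lebesgue_measure]_(x in `]0, 1[) g2 (p x) =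
    ref_integral 1 (fun t : 'rV_1 => h2 (v ord0 + t *m edges v)).
  by apply: eq_Rintegral => x xI; rewrite /= pE; have [_ ->] := hp _ xI.
ring.
Qed.

End Reference_integrals.

(** * Linear matrix-valued maps *)

Section Linear_matrix_maps.
Variables (R : comNzRingType) (U : lmodType R).

(** Entrywise, as for [tendsm]. *)
Definition linm p q (f : U -> 'M[R]_(p, q)) : Prop :=
  forall a b, lin (fun u => f u a b).

Lemma linm_tr p q (f : U -> 'M[R]_(p, q)) : linm f -> linm (fun u => (f u)^T).
Proof. by move=> hf a b c u v; rewrite !mxE; exact: hf. Qed.

Lemma linmD p q (f g : U -> 'M[R]_(p, q)) :
  linm f -> linm g -> linm (fun u => f u + g u).
Proof. by move=> hf hg a b c u v; rewrite !mxE hf hg; ring. Qed.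

Lemma linm_mull p q r (A : 'M[R]_(p, q)) (f : U -> 'M[R]_(q, r)) :
  linm f -> linm (fun u => A *m f u).
Proof.
move=> hf a b; rewrite (_ : (fun _ => _) = fun u => \sum_i A a i * f u i b).
  by apply: lin_sum => i; apply: linMl.
by apply/funext => u; rewrite mxE.
Qed.

Lemma linm_mulr p q r (A : 'M[R]_(q, r)) (f : U -> 'M[R]_(p, q)) :
  linm f -> linm (fun u => f u *m A).
Proof.
move=> hf a b; rewrite (_ : (fun _ => _) = fun u => \sum_i f u a i * A i b).
  by apply: lin_sum => i; apply: linMr.
by apply/funext => u; rewrite mxE.
Qed.

Lemma linm_row p q (f : U -> 'M[R]_(p, q)) k :
  linm f -> linm (fun u => row k (f u)).
Proof. by move=> hf a b c u v; rewrite !mxE; exact: hf. Qed.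

Lemma lin_trace p (f : U -> 'M[R]_p) : linm f -> lin (fun u => \tr (f u)).
Proof. by move=> hf; apply: lin_sum => i. Qed.

End Linear_matrix_maps.

Section Linear_products.
Variables (R : realType) (U : lmodType R).

Lemma lin_dotvl p (f : U -> 'rV[R]_p) x : linm f -> lin (fun u => dotv (f u) x).
Proof. by move=> hf; apply: lin_sum => i; apply: linMr. Qed.

Lemma lin_dotvr p (f : U -> 'rV[R]_p) x : linm f -> lin (fun u => dotv x (f u)).
Proof. by move=> hf; apply: lin_sum => i; apply: linMl. Qed.

Lemma lin_frobl p (f : U -> 'M[R]_p) A : linm f -> lin (fun u => frob (f u) A).
Proof. by move=> hf; apply: lin_trace; apply: linm_mulr; apply: linm_tr. Qed.

Lemma lin_frobr p (f : U -> 'M[R]_p) A : linm f -> lin (fun u => frob A (f u)).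
Proof. by move=> hf; apply: lin_trace; apply: linm_mull. Qed.

End Linear_products.

(** * Interpolation of vector fields *)

Section Nodal_forms.
Variables (R : realType) (n : nat) (T : triangulation R n).
Hypothesis hT : polyhedral_surface T.
Hypothesis A1 : forall j, 0 < simp_measure (T := T) j.

Notation E := 'rV[R]_n.+2.
Notation J := 'I_(nsimp T).
Notation K := 'I_(nvert T).
Notation scal := 'cV[R]_(nvert T).
Notation vecf := 'M[R]_(nvert T, n.+2).
Implicit Types (j : J) (k : K) (l : 'I_n.+2) (X Y Z W : vecf).

Definition interpv X (x : E) : E := \row_i interp (col i X) x.

Lemma interpv_vertex X k : interpv X (vertex k) = row k X.
Proof. by apply/rowP => i; rewrite !mxE interp_vertex // mxE. Qed.

Lemma interpvK X : nodalv T (interpv X) = X.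
Proof. by apply/row_matrixP => k; rewrite row_nodalv interpv_vertex. Qed.

Lemma interpv_comp X i : (fun x => interpv X x 0 i) = interp (col i X).
Proof. by apply/funext => x; rewrite mxE. Qed.

Lemma nodalvK (f : E -> E) : vec (V T) f -> interpv (nodalv T f) = f.
Proof.
move=> fV; apply/funext => x; apply/rowP => i.
by rewrite mxE col_nodalv nodalK.
Qed.

Lemma vecV_interpv X : vec (V T) (interpv X).
Proof. by move=> i; rewrite interpv_comp; exact: V_interp. Qed.

Lemma vecV0_interpv X : (forall k, bd T (vertex k) -> row k X = 0) ->
  vec (V0 T) (interpv X).
Proof.
move=> X0 i; rewrite interpv_comp; apply: V0_interp => // k /X0 /rowP /(_ i).
by rewrite !mxE.
Qed.

Lemma vecV1_interpv X : (forall k, bd1 T (vertex k) -> row k X = 0) ->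
  vec (V1 T) (interpv X).
Proof.
move=> X0 i; rewrite interpv_comp; apply: V1_interp => // k /X0 /rowP /(_ i).
by rewrite !mxE.
Qed.

Definition at_pt X j l : E := row (simp j l) X.

Lemma at_ptE (f : E -> E) j l : f (simp_pt j l) = at_pt (nodalv T f) j l.
Proof. by rewrite /at_pt row_nodalv. Qed.

(** * Sums over simplices *)

Definition simp_sum (c : J -> R) : R := \sum_j simp_measure j * c j.

(** On the surface the scheme integrates exactly only products of gradients, which
are constant on each open simplex. *)
Lemma L2E (h : J -> E -> R) c : (forall j x, osimplex j x -> h j x = c j) ->
  L2 h = simp_sum c.
Proof.
move=> hc; apply: eq_bigr => j _; apply: simplex_integral_cst => b b0 b1.
by apply: hc; exact: osimplex_combination.
Qed.

Lemma simp_sum_linear a (c d : J -> R) :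
  simp_sum (fun j => a * c j + d j) = a * simp_sum c + simp_sum d.
Proof.
by rewrite mulr_sumr -big_split; apply: eq_bigr => j _ /=; ring.
Qed.

Lemma lumpD (H G : J -> 'I_n.+2 -> R) :
  lump (fun j l => H j l + G j l) = lump H + lump G.
Proof.
rewrite -mulrDr -big_split; congr (_ * _); apply: eq_bigr => j _ /=.
by rewrite big_split mulrDr.
Qed.

Lemma simp_sum_ge0 c : (forall j, 0 <= c j) -> 0 <= simp_sum c.
Proof. by move=> c0; apply: sumr_ge0 => j _; rewrite mulr_ge0 // ltW. Qed.

Lemma simp_sum_eq0 c : (forall j, 0 <= c j) -> simp_sum c = 0 -> forall j, c j = 0.
Proof.
move=> c0 /eqP; rewrite psumr_eq0 => [/allP h j|j _]; last by rewrite mulr_ge0 // ltW.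
have := h j; rewrite mem_index_enum mulf_eq0 gt_eqF // => /(_ isT) /=.
by move/eqP.
Qed.

Lemma lump_ge0 (H : J -> 'I_n.+2 -> R) : (forall j l, 0 <= H j l) -> 0 <= lump H.
Proof.
move=> H0; rewrite mulr_ge0 ?invr_ge0 ?ler0n //.
by apply: simp_sum_ge0 => j; exact: sumr_ge0.
Qed.

Lemma lump_eq0 (H : J -> 'I_n.+2 -> R) : (forall j l, 0 <= H j l) ->
  lump H = 0 -> forall j l, H j l = 0.
Proof.
move=> H0 /eqP; rewrite mulf_eq0 invr_eq0 pnatr_eq0 /= => /eqP h j l.
have /eqP := simp_sum_eq0 (fun j => sumr_ge0 _ (fun l _ => H0 j l)) h j.
rewrite psumr_eq0 // => /allP /(_ l); rewrite mem_index_enum => /(_ isT).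
by move/eqP.
Qed.

Lemma lin_simp_sum (U : lmodType R) (c : U -> J -> R) :
  (forall j, lin (fun u => c u j)) -> lin (fun u => simp_sum (c u)).
Proof. by move=> hc; apply: lin_sum => j; apply: linMl. Qed.

Lemma lin_lump (U : lmodType R) (H : U -> J -> 'I_n.+2 -> R) :
  (forall j l, lin (fun u => H u j l)) -> lin (fun u => lump (H u)).
Proof.
move=> hH; apply: linMl; apply: lin_simp_sum => j.
by apply: lin_sum => l.
Qed.

Lemma linm_at_pt (U : lmodType R) (f : U -> vecf) j l :
  linm f -> linm (fun u => at_pt (f u) j l).
Proof. exact: linm_row. Qed.

Lemma linm_gradv (U : lmodType R) (f : U -> vecf) j :
  linm f -> linm (fun u => gradv (f u) j).
Proof.
move=> hf a b; rewrite (_ : (fun _ => _) =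
    fun u => \sum_i f u (simp j i) a * (bgrad j i *m Pmx j) 0 b).
  by apply: lin_sum => i; apply: linMr.
apply/funext => u; rewrite mxE /grad /local_grad mulmx_suml summxE.
by apply: eq_bigr => i _; rewrite -scalemxAl !mxE.
Qed.

Lemma linm_Pv (U : lmodType R) (f : U -> E) j :
  linm f -> linm (fun u => Pv j (f u)).
Proof. by move=> hf; apply: linm_tr; apply: linm_mull; apply: linm_tr. Qed.

(** * Regrouping by vertices *)

Definition star_mass k : R := \sum_(j | k \in simp_verts j) simp_measure j.

Lemma star_mass_gt0 k : 0 < star_mass k.
Proof.
have [j kj] := vertex_used hT k.
rewrite /star_mass (bigD1 j) //= ltr_pwDl // sumr_ge0 // => i _.
by rewrite ltW.
Qed.

Lemma lump_vertices (H : J -> K -> R) :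
  lump (fun j l => H j (simp j l)) =
  (n.+2%:R)^-1 * \sum_k \sum_(j | k \in simp_verts j) simp_measure j * H j k.
Proof.
congr (_ * _); rewrite (exchange_big_dep xpredT) //=; apply: eq_bigr => j _.
rewrite -mulr_sumr big_imset //=.
by move=> ? ? _ _; exact: (simp_inj hT).
Qed.

Lemma vertex_normalE k : vertex_normal k =
  (star_mass k)^-1 *: \sum_(j | k \in simp_verts j) simp_measure j *: nu j.
Proof.
have e j : `[< csimplex j (vertex k) >] = (k \in simp_verts j).
  by apply/asboolP/idP => /csimplex_vertex; apply.
by rewrite /vertex_normal /star_mass; congr (_^-1 *: _); apply: eq_bigl.
Qed.

(** The elementwise normals enter through their weighted mean over the star of
the vertex, which is the vertex normal. This links the normal terms of the
scheme to the assumptions on vertex normals. *)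
Lemma lump_normal (F : K -> E) :
  lump (fun j l => dotv (F (simp j l)) (nu j)) =
  (n.+2%:R)^-1 * \sum_k star_mass k * dotv (F k) (vertex_normal k).
Proof.
rewrite (lump_vertices (fun j k => dotv (F k) (nu j))); congr (_ * _).
apply: eq_bigr => k _; rewrite vertex_normalE dotvZr mulrA mulfV ?mul1r; last first.
  by rewrite gt_eqF // star_mass_gt0.
by rewrite dotv_sumr; apply: eq_bigr => j _; rewrite dotvZr.
Qed.

(** * The lumped projection of the transport term *)

(** The mass matrix of the lumped product is diagonal, so the projection is a
weighted mean over the star of each vertex. *)
Definition star_mean (g : J -> K -> R) : scal :=
  \col_k ((star_mass k)^-1 *
    \sum_(j | k \in simp_verts j) simp_measure j * g j k).

(** Regrouping by vertices turns the defining relation into one scalar equation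
per vertex, with coefficient [star_mass k > 0]. *)
Lemma Ch_spec (kap : E -> R) (eta : E -> E) : V T kap -> vec (V T) eta ->
  V T (Ch T kap eta) /\
  nodal T (Ch T kap eta) =
    star_mean (fun j k => dotv (row k (nodalv T eta)) (grad (nodal T kap) j)).
Proof.
move=> kV eV.
set g := fun j k => _.
have lumpR chi : V T chi ->
    lumped (fun j x => dotv (eta x) (sgrad kap j x) * chi x) =
    lump (fun j l => g j (simp j l) * chi (vertex (simp j l))).
  move=> chiV; apply: lumpedE => // j l.
  apply: tendsM => //; last exact: tends_V.
  rewrite /g row_nodalv; apply: tends_dotv => //; first exact: tendsm_V.
  by apply: tendsm_eq => // x; exact: sgrad_V.
have lumpL c chi : V T c -> V T chi ->
    lumped (fun (j : J) x => c x * chi x) =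
    lump (fun j l => c (vertex (simp j l)) * chi (vertex (simp j l))).
  by move=> cV chiV; apply: lumpedE => // j l; apply: tendsM => //; exact: tends_V.
have ex : exists c, V T c /\ forall chi, V T chi ->
    lumped (fun (j : J) x => c x * chi x) =
    lumped (fun j x => dotv (eta x) (sgrad kap j x) * chi x).
  exists (interp (star_mean g)); split=> [|chi chiV]; first exact: V_interp.
  rewrite lumpR // lumpL //; last exact: V_interp.
  rewrite (lump_vertices (fun _ k => interp _ (vertex k) * chi (vertex k))).
  rewrite (lump_vertices (fun j k => g j k * chi (vertex k))).
  congr (_ * _); apply: eq_bigr => k _.
  rewrite interp_vertex // -mulr_suml -/(star_mass k) mxE !mulrA mulfV ?mul1r.
    by rewrite mulr_suml; apply: eq_bigr => j _; rewrite mulrA.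
  by rewrite gt_eqF // star_mass_gt0.
have [cV cE] := xgetPex (fun=> 0 : R) ex; split=> //.
rewrite -/(Ch T kap eta) in cV cE.
apply/colP => k; rewrite !mxE.
(* The nodal basis function of [k] isolates the equation of that vertex. *)
have chiV := V_interp hT A1 (delta_mx k 0).
have := cE _ chiV; rewrite lumpR // lumpL //.
rewrite (lump_vertices (fun _ k' => Ch T kap eta (vertex k') * interp _ (vertex k'))).
rewrite (lump_vertices (fun j k' => g j k' * interp _ (vertex k'))).
move=> /mulfI h.
have {h} := h _; rewrite invr_eq0 pnatr_eq0 => /(_ isT).
have pick (F : J -> K -> R) : \sum_k' \sum_(j | k' \in simp_verts j)
    simp_measure j * (F j k' * interp (delta_mx k 0) (vertex k')) =
    \sum_(j | k \in simp_verts j) simp_measure j * F j k.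
  rewrite (bigD1 k) //= [X in _ + X]big1 ?addr0.
    apply: eq_bigr => j _; rewrite interp_vertex // mxE !eqxx.
    by rewrite mulr1.
  move=> k' k'k; apply: big1 => j _; rewrite interp_vertex // mxE.
  by rewrite (negbTE k'k) !mulr0.
rewrite (pick (fun _ k' => Ch T kap eta (vertex k'))) (pick g) => <-.
rewrite -mulr_suml -/(star_mass k) mulrA mulVf ?mul1r //.
by rewrite gt_eqF // star_mass_gt0.
Qed.

End Nodal_forms.

(** * The data functionals *)

Section Scheme.
Variables (R : realType) (n : nat) (T : triangulation R n).
Hypothesis hT : polyhedral_surface T.
Hypothesis A1 : forall j, 0 < simp_measure (T := T) j.

Notation E := 'rV[R]_n.+2.
Notation J := 'I_(nsimp T).
Notation K := 'I_(nvert T).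
Notation scal := 'cV[R]_(nvert T).
Notation vecf := 'M[R]_(nvert T, n.+2).
Implicit Types (j : J) (k : K) (l : 'I_n.+2) (X Y Z W P Q : vecf) (L r : scal).

Lemma lumped_lin (U : lmodType R) (h : U -> J -> E -> R) H :
  (forall u j l, tends j l (h u j) (H u j l)) ->
  (forall j l, lin (fun u => H u j l)) -> lin (fun u => lumped (h u)).
Proof.
move=> hH Hl; rewrite (_ : (fun _ => _) = fun u => lump (H u)).
  exact: lin_lump.
by apply/funext => u; apply: lumpedE.
Qed.

Lemma interpv_lin c X Y x :
  interpv (c *: X + Y) x = c *: interpv X x + interpv Y x.
Proof.
apply/rowP => i; rewrite !mxE /interp; case: pickP => [j _|_]; last first.
  by rewrite mulr0 addr0.
rewrite /local_interp mulr_sumr -big_split; apply: eq_bigr => l _ /=.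
by rewrite !mxE; ring.
Qed.

Lemma tends_sgradv j l (f : E -> E) : vec (V T) f ->
  tendsm j l (sgradv f j) (gradv (nodalv T f) j).
Proof. by move=> fV; apply: tendsm_eq => x jx; exact: sgradv_V. Qed.

Lemma tends_sgradv_interpv j l X :
  tendsm j l (sgradv (interpv X) j) (gradv X j).
Proof.
rewrite -{2}[X](interpvK hT A1); apply: tends_sgradv; exact: vecV_interpv.
Qed.

Lemma tends_sgradv_id j l : tendsm j l (sgradv id j) (Pmx j).
Proof. by apply: tendsm_eq => x; exact: sgradv_id. Qed.

Lemma linm_id p q : linm (fun X : 'M[R]_(p, q) => X).
Proof. by move=> a b c u v; rewrite !mxE. Qed.

(** Every term is an exact or a lumped integral of an expression linear in the
nodal values; for the transport term this is the formula of [Ch_spec]. *)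
Lemma Rh_lin (km : E -> E) (kap : E -> R) : vec (V T) km -> V T kap ->
  lin (fun X => Rh T km kap (interpv X)).
Proof.
move=> kmV kapV.
have GL j : linm (fun X => gradv X j) by apply: linm_gradv; exact: linm_id.
apply: linD; first apply: linD; first apply: linD; first apply: linD.
- rewrite (_ : (fun _ => _) = fun X => simp_sum (fun j =>
    \tr (gradv (nodalv T km) j) * \tr (gradv X j))).
    by apply: lin_simp_sum => j; apply: linMl; apply: lin_trace.
  apply/funext => X; apply: L2E => // j x jx.
  rewrite /sdiv !sgradv_V ?interpvK //; exact: vecV_interpv.
- apply: linN; apply: lumped_lin => [X j l|j l].
    apply: tends_frob.
      by apply: tendsm_tr; apply: tends_sgradv.
    apply: tendsm_mul; last by apply: tendsm_tr; exact: tends_sgradv_id.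
    apply: tendsmD; first exact: tends_sgradv_interpv.
    by apply: tendsm_tr; exact: tends_sgradv_interpv.
  apply: lin_frobr; apply: linm_mulr; apply: linmD => //.
  exact: linm_tr.
- apply: lumped_lin => [X j l|j l].
    apply: tendsM; last first.
      apply: tends_frob; first exact: tends_sgradv_id.
      exact: tends_sgradv_interpv.
    apply: tendsB.
      apply: tends_dotv; last exact: tendsm_V.
      apply: tendsmD; first exact: tendsm_V.
      apply: tendsmZ; [exact: tends_V|exact: tendsm_cst].
    apply: tendsM; first exact: tends_cst.
    by apply: tends_dotv; exact: tendsm_V.
  by apply: linMl; exact: lin_frobr.
- apply: linN; apply: lumped_lin => [X j l|j l].
    apply: tends_dotv.
      apply: tendsmZ; [exact: tends_V|exact: tendsm_V].
    apply: tendsm_tr; apply: tendsm_mul; last exact: tendsm_cst.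
    by apply: tendsm_tr; exact: tends_sgradv_interpv.
  apply: lin_dotvr; apply: linm_tr; apply: linm_mulr.
  exact: linm_tr.
- pose C X := nodal T (Ch T kap (interpv X)).
  apply: (@lumped_lin _ _ (fun X j l =>
      dotv (C X (simp j l) 0 *: nu j) (km (simp_pt j l)))).
    move=> X j l; have [CV _] := Ch_spec hT A1 kapV (vecV_interpv hT A1 X).
    rewrite mxE; apply: tends_dotv; last exact: tendsm_V.
    by apply: tendsmZ; [exact: tends_V|exact: tendsm_cst].
  move=> j l; rewrite (_ : (fun _ => _) = fun X =>
      C X (simp j l) 0 * dotv (nu j) (km (simp_pt j l))); last first.
    by apply/funext => X; rewrite dotvZl.
  apply: linMr; rewrite (_ : (fun _ => _) = fun X =>
      (star_mass (simp j l))^-1 *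
      \sum_(i | simp j l \in simp_verts i) simp_measure i *
         dotv (row (simp j l) X) (grad (nodal T kap) i)).
    apply: linMl; apply: lin_sum => i; apply: linMl; apply: lin_dotvl.
    by apply: linm_row; exact: linm_id.
  apply/funext => X; rewrite /C.
  have [_ ->] := Ch_spec hT A1 kapV (vecV_interpv hT A1 X).
  by rewrite mxE (interpvK hT A1).
Qed.

Lemma facet_combination (F : J * 'I_n.+2) (b : 'I_n.+1 -> R) :
  (forall i, 0 < b i) -> \sum_i b i = 1 ->
  hull (facet_verts F) (\sum_i b i *: facet_pt F i).
Proof.
move=> b0 b1.
have gI : injective (fun i => simp F.1 (lift F.2 i)).
  by move=> i i' /(simp_inj hT) /lift_inj.
apply/(imset_combination (@vertex R n T) (fun c => 0 <= c) _ gI).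
by exists b; split=> // i; exact: ltW.
Qed.

(** Additivity of the boundary integral needs integrability. It holds because on
each facet of the boundary part both fields are affine. *)
Lemma boundary_lin (mu M : E -> E) : (n <= 1)%N -> vec (V T) M ->
  (forall x, bd2 T x -> mu x = M x) ->
  lin (fun X => L2_bd2 T (fun x => dotv (mu x) (interpv X x))).
Proof.
move=> n1 MV muM c X Y; rewrite /L2_bd2 mulr_sumr -big_split.
apply: eq_bigr => F FB /=.
have aff f : vec (V T) f -> exists a, exists b, forall x i,
    csimplex F.1 x -> f x 0 i = dotv (a i) x + b i.
  move=> fV; have h i := V_affine hT A1 F.1 (fV i).
  exists (fun i => local_grad (nodal T (fun x => f x 0 i)) F.1).
  exists (fun i => projT1 (cid (h i))) => x i Fx.
  exact: (projT2 (cid (h i))).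
have [aM [bM ME]] := aff _ MV.
have rep Z : exists2 g, continuous g &
    forall x, hull (facet_verts F) x -> dotv (mu x) (interpv Z x) = g x.
  have [aZ [bZ ZE]] := aff _ (vecV_interpv hT A1 Z).
  exists (fun x => \sum_i (dotv (aM i) x + bM i) * (dotv (aZ i) x + bZ i)).
    move=> x; have FF := nbhs_filter x.
    apply: (@cvg_sum_real _ _ _ (nbhs x)) => i _.
    apply: (@cvgM _ _ (nbhs x)); exact: affine_continuous.
  move=> x Fx; have jx := facet_hull_sub Fx.
  rewrite muM; last by exists F.
  by apply: eq_bigr => i _; rewrite ME // ZE.
have [gX cX XE] := rep X; have [gY cY YE] := rep Y.
rewrite -(@simplex_integral_lin _ _ _ (facet_pt F) c _ _ gX gY n1 cX cY).
  by congr (simplex_integral _ _); apply/funext => x; rewrite interpv_lin dotvDr dotvZr.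
by move=> b b0 b1; rewrite XE ?YE //; exact: facet_combination.
Qed.

End Scheme.

(** * The homogeneous problem *)

Section Homogeneous_problem.
Variables (R : realType) (n : nat) (T : triangulation R n).
Hypothesis hT : polyhedral_surface T.
Hypothesis A1 : forall j, 0 < simp_measure (T := T) j.

Notation E := 'rV[R]_n.+2.
Notation J := 'I_(nsimp T).
Notation K := 'I_(nvert T).
Notation scal := 'cV[R]_(nvert T).
Notation vecf := 'M[R]_(nvert T, n.+2).
Implicit Types (j : J) (k : K) (l : 'I_n.+2) (X Y Z W P Q : vecf) (L r : scal).

Variables (dt alpha : R).
Hypotheses (hdt : 0 < dt) (halpha : 0 <= alpha).

Definition dirichlet X Y : R := simp_sum (fun j => frob (gradv X j) (gradv Y j)).

Definition tangential X Y : R :=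
  lump (fun j l => dotv (Pv j (at_pt X j l)) (at_pt Y j l)).

Definition normal_mass r X : R :=
  lump (fun j l => r (simp j l) 0 * dotv (nu j) (at_pt X j l)).

(** The parts of the first, second and fourth equation that are linear in the
unknowns; the third one is [normal_mass r P]. Here [W], [Q], [L] and [P] are the
nodal values of the velocity, the curvature, the multiplier and the adjoint
velocity. *)
Definition form1 W Q P X : R :=
  lump (fun j l => dotv (at_pt W j l) (nu j) * dotv (at_pt X j l) (nu j))
  - dirichlet Q X + tangential X P + alpha * dirichlet X P.

Definition form2 W Q Y : R :=
  lump (fun j l => dotv (at_pt Q j l) (at_pt Y j l)) + dt * dirichlet W Y.

Definition form4 W L Z : R :=
  tangential W Z + normal_mass L Z + alpha * dirichlet W Z.

Section Linearity.
Variable U : lmodType R.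
Implicit Types (f : U -> vecf) (g : U -> scal).

Lemma lin_dirichletl f Y : linm f -> lin (fun s => dirichlet (f s) Y).
Proof.
by move=> hf; apply: lin_simp_sum => j; apply: lin_frobl; exact: linm_gradv.
Qed.

Lemma lin_dirichletr f Y : linm f -> lin (fun s => dirichlet Y (f s)).
Proof.
by move=> hf; apply: lin_simp_sum => j; apply: lin_frobr; exact: linm_gradv.
Qed.

Lemma lin_tangentiall f Y : linm f -> lin (fun s => tangential (f s) Y).
Proof.
move=> hf; apply: lin_lump => j l; apply: lin_dotvl; apply: linm_Pv.
exact: linm_at_pt.
Qed.

Lemma lin_tangentialr f Y : linm f -> lin (fun s => tangential Y (f s)).
Proof.
by move=> hf; apply: lin_lump => j l; apply: lin_dotvr; exact: linm_at_pt.
Qed.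

Lemma lin_normal_massl g X : linm g -> lin (fun s => normal_mass (g s) X).
Proof. by move=> hg; apply: lin_lump => j l; apply: linMr. Qed.

Lemma lin_normal_massr f r : linm f -> lin (fun s => normal_mass r (f s)).
Proof.
move=> hf; apply: lin_lump => j l; apply: linMl; apply: lin_dotvr.
exact: linm_at_pt.
Qed.

End Linearity.

Lemma dirichlet0 Y : dirichlet 0 Y = 0.
Proof. exact: (lin0 (lin_dirichletl Y (@linm_id _ _ _))). Qed.

Lemma tangential0 Y : tangential 0 Y = 0.
Proof. exact: (lin0 (lin_tangentiall Y (@linm_id _ _ _))). Qed.

Lemma lump0 (H : J -> 'I_n.+2 -> R) : (forall j l, H j l = 0) -> lump H = 0.
Proof.
by move=> H0; rewrite /lump big1 ?mulr0 // => j _; rewrite big1 ?mulr0.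
Qed.

Lemma dirichletC X Y : dirichlet X Y = dirichlet Y X.
Proof. by apply: eq_bigr => j _; rewrite frobC. Qed.

Lemma dirichlet_ge0 X : 0 <= dirichlet X X.
Proof. by apply: (simp_sum_ge0 A1) => j; exact: frob_ge0. Qed.

Lemma dirichlet_eq0 X : dirichlet X X = 0 -> forall j, gradv X j = 0.
Proof.
move=> h j; apply: frob_eq0; apply: (simp_sum_eq0 A1 _ h) => i; exact: frob_ge0.
Qed.

Lemma PvE j (v : E) : Pv j v = v - dotv v (nu j) *: nu j.
Proof.
rewrite /Pv trmx_mul trmxK Pmx_tr /Pmx mulmxBr mulmx1 mulmxA.
by rewrite [v *m _]mx11_scalar -dotvE mul_scalar_mx.
Qed.

(** Since [nu j] is a unit vector, [Pv j] is an orthogonal projection. *)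
Lemma dotv_Pv j (v : E) : dotv (Pv j v) v = dotv (Pv j v) (Pv j v).
Proof.
rewrite !PvE; move: (nu j) (nu_unit A1 j) => m m1.
by rewrite !dotvBl !dotvBr !dotvZl !dotvZr m1 (dotvC m v); ring.
Qed.

Lemma tangential_ge0 X : 0 <= tangential X X.
Proof. by apply: (lump_ge0 A1) => j l; rewrite dotv_Pv dotv_ge0. Qed.

Lemma tangential_eq0 X : tangential X X = 0 ->
  forall j l, at_pt X j l = dotv (at_pt X j l) (nu j) *: nu j.
Proof.
move=> h j l; apply/eqP; rewrite -subr_eq0 -PvE; apply/eqP/dotv_eq0.
rewrite -dotv_Pv.
by apply: (lump_eq0 A1 _ h) => i q; rewrite dotv_Pv dotv_ge0.
Qed.

Lemma normal_mass_vertices r X : normal_mass r X =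
  (n.+2%:R)^-1 * \sum_k star_mass k * (r k 0 * dotv (row k X) (vertex_normal k)).
Proof.
under eq_bigr do rewrite -dotvZl.
rewrite -(lump_normal hT A1 (fun k => r k 0 *: row k X)).
congr (_ * _); apply: eq_bigr => j _; congr (_ * _); apply: eq_bigr => l _.
by rewrite dotvZl (dotvC (nu j)).
Qed.

(** If [f] is constant on each simplex, the simplices where it equals [f k] and
the others form two closed sets covering the surface. They are disjoint, since
simplices that meet share a vertex. *)
Lemma connected_cst (S : eqType) (f : K -> S) : connected (Gam T) ->
  (forall j l l', f (simp j l) = f (simp j l')) -> forall k k', f k = f k'.
Proof.
move=> conn fc k0 k1.
pose C := \bigcup_(j in [set j | f (simp j ord0) = f k0]) csimplex j.
pose D := \bigcup_(j in [set j | f (simp j ord0) <> f k0]) csimplex j.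
have closedU (B : set J) : closed (\bigcup_(j in B) csimplex j).
  apply: closed_bigcup; first exact: finite_finset.
  by move=> j _; exact: csimplex_closed.
have disj x : C x -> D x -> False.
  move=> [i /= iC ix] [j /= jD jx]; have : (csimplex i `&` csimplex j) x by [].
  rewrite (simp_conforming hT) => -[c [_ c1 _]].
  have [k /[!finset.in_setI] /andP[]] :
      exists k, k \in (simp_verts i :&: simp_verts j)%SET.
    apply/finset.set0Pn; apply/eqP => S0; move: c1; rewrite S0 big_set0 => /eqP.
    by rewrite eq_sym oner_eq0.
  move=> /imsetP [l _ ->] /imsetP [l' _ e]; apply: jD.
  by rewrite (fc j _ l') -e (fc i _ ord0).
have mem k : exists2 j, csimplex j (vertex k) & f (simp j ord0) = f k.
  have [j /[dup] kj /imsetP [l _ kE]] := vertex_used hT k.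
  by exists j; [exact: vertex_hull|rewrite kE; exact: fc].
have e : Gam T `&` C = Gam T.
  apply: conn; last by exists C; first exact: closedU.
    have [j jk fj] := mem k0.
    by exists (vertex k0); split; exists j.
  exists (~` D); first by apply: closed_openC; exact: closedU.
  apply/seteqP; split=> x [Gx Cx]; split=> //; first by move=> /(disj x Cx).
  case: Gx => j _ jx; exists j => //=; apply: contrapT => fj.
  by apply: Cx; exists j.
have [j jk fj] := mem k1.
have : (Gam T `&` C) (vertex k1) by rewrite e; exists j.
move=> [_ Ck]; rewrite -fj; apply/esym; apply: contrapT => ne.
by apply: (disj _ Ck); exists j.
Qed.

(** The edges are tangential, so a field without surface gradient takes equal
values at the vertices of each simplex. *)
Lemma gradv0_cst X : connected (Gam T) -> (forall j, gradv X j = 0) ->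
  forall k k', row k X = row k' X.
Proof.
move=> conn X0; apply: connected_cst => // j.
suff h l : row (simp j l) X = row (simp j ord0) X by move=> l l'; rewrite !h.
apply/rowP => i; rewrite ![row _ _ _ _]mxE.
have <- : col i X (simp j l) 0 = X (simp j l) i by rewrite mxE.
have <- : col i X (simp j ord0) 0 = X (simp j ord0) i by rewrite mxE.
rewrite -!(local_interp_pt A1); have [b bE] := local_interpE (col i X) j.
apply/eqP; rewrite -subr_eq0 !bE opprD addrACA subrr addr0 -dotvBr; apply/eqP.
set e := _ - _; have eP : e = e *m Pmx j.
  rewrite mulmxBr mulmx1 mulmxA [e *m _]mx11_scalar -dotvE (nu_edge A1).
  by rewrite mul_scalar_mx scale0r subr0.
rewrite eP dotvE trmx_mul Pmx_tr mulmxA.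
have := congr1 (row i) (X0 j); rewrite rowK row0 /grad => ->.
by rewrite mul0mx mxE.
Qed.

Lemma span_orth_eq0 (s : seq E) (v : E) : \dim << s >>%VS = n.+2 ->
  (forall x, x \in s -> dotv v x = 0) -> v = 0.
Proof.
move=> ds sv; apply: dotv_eq0.
suff : v \in << s >>%VS.
  rewrite -[s]/(tval (in_tuple s)) => /coord_span vE.
  rewrite {2}vE dotv_sumr big1 // => i _; rewrite dotvZr sv ?mulr0 //.
  by rewrite mem_nth.
have -> : << s >>%VS = fullv by apply/eqP; rewrite eqEdim subvf dimvf ds /dim /= mul1n.
exact: memvf.
Qed.

(** Testing the equations with [W], [Q], [L] and [P] themselves leaves the energy
identity [|Q| ^ 2 + dt |W . nu| ^ 2 = 0]. With [Q = 0] the second equation gives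
[W] a vanishing gradient, so [W] is constant; being orthogonal to all the vertex
normals, which span the space, it is zero. The fourth equation is then a weighted
sum of [L k] times vertex normals. Finally the first one makes [P] parallel to all
the normals around each vertex, while the third one makes it orthogonal to their
mean. *)
Lemma homogeneous_trivial W Q L P : connected (Gam T) ->
  \dim <<[seq vertex_normal k | k : K in
           [pred k | `[< free_vertex k >]]]>>%VS = n.+2 ->
  (forall k, free_vertex k -> vertex_normal k <> 0) ->
  (forall k, bd T (vertex k) -> row k W = 0) ->
  (forall k, bd1 T (vertex k) -> row k Q = 0) ->
  (forall k, bd T (vertex k) -> L k 0 = 0) ->
  (forall k, bd T (vertex k) -> row k P = 0) ->
  (forall X, (forall k, bd T (vertex k) -> row k X = 0) -> form1 W Q P X = 0) ->
  (forall Y, (forall k, bd1 T (vertex k) -> row k Y = 0) -> form2 W Q Y = 0) ->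
  (forall r, (forall k, bd T (vertex k) -> r k 0 = 0) -> normal_mass r P = 0) ->
  (forall Z, (forall k, bd T (vertex k) -> row k Z = 0) -> form4 W L Z = 0) ->
  [/\ W = 0, Q = 0, L = 0 & P = 0].
Proof.
move=> conn A2 A3 W0 Q0 L0 P0 h1 h2 h3 h4.
set A := lump (fun j l => dotv (at_pt W j l) (nu j) * dotv (at_pt W j l) (nu j)).
set B := lump (fun j l => dotv (at_pt Q j l) (at_pt Q j l)).
have A0 : 0 <= A by apply: (lump_ge0 A1) => j l; rewrite -expr2 sqr_ge0.
have B0 : 0 <= B by apply: (lump_ge0 A1) => j l; exact: dotv_ge0.
have energy : B + dt * A = 0.
  have e1 : A - dirichlet Q W + tangential W P + alpha * dirichlet W P = 0 := h1 W W0.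
  have e2 : B + dt * dirichlet W Q = 0 := h2 Q Q0.
  have e4 := h4 P P0; rewrite /form4 (h3 L L0) in e4.
  have -> : A = dirichlet W Q by rewrite dirichletC; lra.
  exact: e2.
have dtA0 : 0 <= dt * A by rewrite mulr_ge0 // ltW.
have {dtA0} [AE BE] : A = 0 /\ B = 0.
  split; last by lra.
  have /eqP : dt * A = 0 by lra.
  by rewrite mulf_eq0 (gt_eqF hdt) => /eqP.
have W_nu k j : k \in simp_verts j -> dotv (row k W) (nu j) = 0.
  move=> /imsetP [l _ ->]; have /eqP := lump_eq0 A1 (fun i q => sqr_ge0 _) AE j l.
  by rewrite mulf_eq0 orbb => /eqP.
have QE : Q = 0.
  apply/row_matrixP => k; rewrite row0; have [j /imsetP [l _ ->]] := vertex_used hT k.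
  exact: dotv_eq0 (lump_eq0 A1 (fun i q => dotv_ge0 _) BE j l).
have WE : W = 0.
  have gW : forall j, gradv W j = 0.
    apply: dirichlet_eq0; have := h2 W (fun k kb => W0 k (bd1_sub hT kb)).
    rewrite /form2 QE lump0; last by move=> j l; rewrite /at_pt row0 dotv0l.
    by rewrite add0r => /eqP; rewrite mulf_eq0 gt_eqF // => /eqP.
  apply/row_matrixP => k; rewrite row0; apply: (span_orth_eq0 A2) => x.
  move=> /fintype.imageP [k' _ ->]; rewrite (gradv0_cst conn gW k k').
  rewrite (vertex_normalE hT A1) dotvZr dotv_sumr big1 ?mulr0 // => j kj.
  by rewrite dotvZr W_nu ?mulr0.
(* The weights [star_mass k] are positive. *)
have star_eq0 (F : K -> R) : (forall k, 0 <= F k) ->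
    (n.+2%:R)^-1 * \sum_k star_mass k * F k = 0 -> forall k, F k = 0.
  move=> F0 /eqP; rewrite mulf_eq0 invr_eq0 pnatr_eq0 /= psumr_eq0; last first.
    by move=> k _; rewrite mulr_ge0 // ltW // star_mass_gt0.
  move=> /allP h k; have := h k; rewrite mem_index_enum => /(_ isT).
  by rewrite mulf_eq0 (gt_eqF (star_mass_gt0 hT A1 k)) => /eqP.
have LE : L = 0.
  (* This test field makes the contribution of every vertex to
     [normal_mass L Z] nonnegative. *)
  pose Z : vecf := \matrix_k (L k 0 *: vertex_normal k).
  have Z0 k : bd T (vertex k) -> row k Z = 0.
    by move=> kb; rewrite rowK L0 // scale0r.
  have := h4 Z Z0; rewrite /form4 WE tangential0 dirichlet0 mulr0 addr0 add0r.
  rewrite normal_mass_vertices.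
  have ZE k : L k 0 * dotv (row k Z) (vertex_normal k) =
      L k 0 ^+ 2 * dotv (vertex_normal k) (vertex_normal k).
    by rewrite rowK dotvZl mulrA.
  move=> /star_eq0 h; apply/colP => k; rewrite [RHS]mxE.
  have [/L0 //|kf] := pselect (bd T (vertex k)).
  have Z_ge0 q : 0 <= L q 0 * dotv (row q Z) (vertex_normal q).
    by rewrite ZE mulr_ge0 ?sqr_ge0 ?dotv_ge0.
  have /eqP := h Z_ge0 k; rewrite ZE mulf_eq0 sqrf_eq0.
  by move=> /orP [/eqP //|/eqP /dotv_eq0 /(A3 k kf)].
have PE : P = 0.
  have tP : tangential P P = 0.
    have := h1 P P0; rewrite /form1 WE QE dirichlet0 lump0; last first.
      by move=> j l; rewrite /at_pt row0 dotv0l mul0r.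
    have := tangential_ge0 P; have : 0 <= alpha * dirichlet P P.
      by rewrite mulr_ge0 // dirichlet_ge0.
    by move=> ? ? ?; lra.
  (* Likewise for [normal_mass r P]. *)
  pose r : scal := \col_k dotv (row k P) (vertex_normal k).
  have r0 k : bd T (vertex k) -> r k 0 = 0.
    by move=> kb; rewrite mxE P0 // dotv0l.
  have := h3 r r0; rewrite normal_mass_vertices => /star_eq0 h.
  have Pn k : dotv (row k P) (vertex_normal k) = 0.
    have r_ge0 q : 0 <= r q 0 * dotv (row q P) (vertex_normal q).
      by rewrite mxE -expr2 sqr_ge0.
    by have /eqP := h r_ge0 k; rewrite mxE mulf_eq0 orbb => /eqP.
  apply/row_matrixP => k; rewrite row0.
  have [/P0 //|kf] := pselect (bd T (vertex k)).
  (* [row k P] is a multiple of every [nu j] around [k]; averaging this relation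
     gives [|row k P| ^ 2] times the vertex normal as a multiple of their dot
     product. *)
  have nuP j : k \in simp_verts j ->
      dotv (row k P) (row k P) *: nu j = dotv (row k P) (nu j) *: row k P.
    move=> /imsetP [l _ kE]; have := tangential_eq0 tP j l.
    rewrite /at_pt -kE; move: (row k P) (nu j) => p m pE.
    have -> : dotv p p = dotv p m * dotv p m by rewrite {2}pE dotvZr.
    by rewrite -scalerA -pE.
  apply: dotv_eq0; apply/eqP/negP => /negP pp; apply: (A3 k kf).
  apply: (scalerI pp); rewrite scaler0 [in LHS](vertex_normalE hT A1).
  rewrite scalerA mulrC -scalerA scaler_sumr.
  have -> : \sum_(j | k \in simp_verts j)
      dotv (row k P) (row k P) *: (simp_measure j *: nu j) =
      \sum_(j | k \in simp_verts j)
        dotv (row k P) (simp_measure j *: nu j) *: row k P.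
    apply: eq_bigr => j kj.
    by rewrite (dotvZr (simp_measure j)) -scalerA -(nuP j kj) scalerA [RHS]scalerA
      [simp_measure j * _]mulrC.
  rewrite -scaler_suml -dotv_sumr scalerA -dotvZr -(vertex_normalE hT A1) Pn.
  by rewrite scale0r.
by [].
Qed.

End Homogeneous_problem.

(** * The scheme as a linear system *)

Section Solvability.
Variables (R : realType) (n : nat) (T : triangulation R n).

Notation E := 'rV[R]_n.+2.
Notation J := 'I_(nsimp T).
Notation K := 'I_(nvert T).
Notation scal := 'cV[R]_(nvert T).
Notation vecf := 'M[R]_(nvert T, n.+2).
Implicit Types (j : J) (k : K) (l : 'I_n.+2) (X Y Z W P Q : vecf) (L r : scal).

(** In the order of the unknowns: velocity, curvature, multiplier and adjoint
velocity. The same type serves for the test fields. *)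
Definition trial : vectType R := (vecf * vecf * scal * vecf)%type.

(** The rows in [B], as a product with a diagonal matrix and thus linear. *)
Definition restr (B : set K) q (X : 'M[R]_(nvert T, q)) : 'M[R]_(nvert T, q) :=
  diag_mx (\row_k (`[< B k >])%:R) *m X.

Lemma restr_eq0 (B : set K) q (X : 'M[R]_(nvert T, q)) :
  restr B X = 0 <-> forall k, B k -> row k X = 0.
Proof.
split=> [B0 k Bk|B0].
  apply/rowP => i; have := congr1 (fun M : 'M[R]_(nvert T, q) => M k i) B0.
  by rewrite /restr mul_diag_mx !mxE; case: asboolP => // _; rewrite mul1r.
apply/matrixP => k i; rewrite /restr mul_diag_mx !mxE.
case: asboolP => [/B0 /rowP /(_ i)|_]; last by rewrite mul0r.
by rewrite !mxE => ->; rewrite mulr0.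
Qed.

Definition on_bd : set K := [set k | bd T (vertex k)].
Definition on_bd1 : set K := [set k | bd1 T (vertex k)].

Definition boundary_values (s : trial) : trial :=
  (restr on_bd s.1.1.1, restr on_bd1 s.1.1.2, restr on_bd s.1.2, restr on_bd s.2).

Lemma boundary_values_linear : linear boundary_values.
Proof.
move=> c u v; rewrite /boundary_values /restr /= !mulmxDr -!scalemxAr.
by [].
Qed.

HB.instance Definition _ :=
  GRing.isLinear.Build R trial trial *:%R boundary_values boundary_values_linear.

(** A kernel, so that it is a subspace in the sense of [galerkin_solvable]. *)
Definition admissible : {vspace trial} := lker (linfun boundary_values).

Lemma admissibleP (s : trial) : s \in admissible <->
  [/\ forall k, bd T (vertex k) -> row k s.1.1.1 = 0,
      forall k, bd1 T (vertex k) -> row k s.1.1.2 = 0,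
      forall k, bd T (vertex k) -> s.1.2 k 0 = 0
    & forall k, bd T (vertex k) -> row k s.2 = 0].
Proof.
rewrite memv_ker lfunE /=; split=>
  [/eqP [] /restr_eq0 h1 /restr_eq0 h2 /restr_eq0 h3 /restr_eq0 h4|[h1 h2 h3 h4]].
  by split=> // k /h3 /rowP /(_ 0); rewrite !mxE.
apply/eqP; congr (_, _, _, _); apply/restr_eq0 => //.
by move=> k kb; apply/rowP => i; rewrite (ord1 i) !mxE h3.
Qed.

Hypothesis hT : polyhedral_surface T.
Hypothesis A1 : forall j, 0 < simp_measure (T := T) j.
Variables (dt alpha : R) (km : E -> E) (kap : E -> R) (mu : E -> E).

(** The sum of the parts linear in the unknowns, each equation being tested with
its own component of [t]. *)
Definition form (s t : trial) : R :=
  form1 alpha s.1.1.1 s.1.1.2 s.2 t.1.1.1 + form2 dt s.1.1.1 s.1.1.2 t.1.1.2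
  + normal_mass t.1.2 s.2 + form4 alpha s.1.1.1 s.1.2 t.2.

(** The parts of the first two equations that do not depend on the unknowns. *)
Definition data1 X : R := Rh T km kap (interpv X).

Definition data2 Y : R :=
  L2_bd2 T (fun x => dotv (mu x) (interpv Y x)) - normal_mass (nodal T kap) Y
  - simp_sum (fun j => frob (Pmx j) (gradv Y j)).

Definition data (t : trial) : R := data1 t.1.1.1 + data2 t.1.1.2.

Let proj1_linm : linm (fun s : trial => s.1.1.1).
Proof. by move=> a b c u v; rewrite !mxE. Qed.
Let proj2_linm : linm (fun s : trial => s.1.1.2).
Proof. by move=> a b c u v; rewrite !mxE. Qed.
Let proj3_linm : linm (fun s : trial => s.1.2).
Proof. by move=> a b c u v; rewrite !mxE. Qed.
Let proj4_linm : linm (fun s : trial => s.2).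
Proof. by move=> a b c u v; rewrite !mxE. Qed.

Lemma form_linl t : lin (form ^~ t).
Proof.
apply: linD; first apply: linD; first apply: linD.
- apply: linD; last by apply: linMl; exact: lin_dirichletr.
  apply: linD; last exact: lin_tangentialr.
  apply: linD; last by apply: linN; exact: lin_dirichletl.
  apply: lin_lump => j l; apply: linMr; apply: lin_dotvl; exact: linm_at_pt.
- apply: linD; last by apply: linMl; exact: lin_dirichletl.
  apply: lin_lump => j l; apply: lin_dotvl; exact: linm_at_pt.
- exact: lin_normal_massr.
- apply: linD; last by apply: linMl; exact: lin_dirichletl.
  apply: linD; first exact: lin_tangentiall.
  exact: lin_normal_massl.
Qed.

Lemma form1_lin W Q P (U : lmodType R) (f : U -> vecf) :
  linm f -> lin (fun u => form1 alpha W Q P (f u)).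
Proof.
move=> hf; apply: linD; last by apply: linMl; exact: lin_dirichletl.
apply: linD; last exact: lin_tangentiall.
apply: linD; last by apply: linN; exact: lin_dirichletr.
apply: lin_lump => j l; apply: linMl; apply: lin_dotvl; exact: linm_at_pt.
Qed.

Lemma form2_lin W Q (U : lmodType R) (f : U -> vecf) :
  linm f -> lin (fun u => form2 dt W Q (f u)).
Proof.
move=> hf; apply: linD; last by apply: linMl; exact: lin_dirichletr.
apply: lin_lump => j l; apply: lin_dotvr; exact: linm_at_pt.
Qed.

Lemma form4_lin W L (U : lmodType R) (f : U -> vecf) :
  linm f -> lin (fun u => form4 alpha W L (f u)).
Proof.
move=> hf; apply: linD; last by apply: linMl; exact: lin_dirichletr.
by apply: linD; [exact: lin_tangentialr|exact: lin_normal_massr].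
Qed.

Lemma form_linr s : lin (form s).
Proof.
apply: linD; first apply: linD; first apply: linD.
- exact: form1_lin.
- exact: form2_lin.
- exact: lin_normal_massl.
- exact: form4_lin.
Qed.

(** Testing with one nonzero component at a time separates the four equations. *)
Lemma form_components (d1 d2 : vecf -> R) (s : trial) : lin d1 -> lin d2 ->
  (forall t, t \in admissible -> form s t = d1 t.1.1.1 + d2 t.1.1.2) <->
  [/\ forall X, (forall k, bd T (vertex k) -> row k X = 0) ->
        form1 alpha s.1.1.1 s.1.1.2 s.2 X = d1 X,
      forall Y, (forall k, bd1 T (vertex k) -> row k Y = 0) ->
        form2 dt s.1.1.1 s.1.1.2 Y = d2 Y,
      forall r, (forall k, bd T (vertex k) -> r k 0 = 0) ->
        normal_mass r s.2 = 0
    & forall Z, (forall k, bd T (vertex k) -> row k Z = 0) ->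
        form4 alpha s.1.1.1 s.1.2 Z = 0].
Proof.
have f1 : form1 alpha s.1.1.1 s.1.1.2 s.2 0 = 0.
  exact: (lin0 (form1_lin _ _ _ (@linm_id _ _ _))).
have f2 : form2 dt s.1.1.1 s.1.1.2 0 = 0.
  exact: (lin0 (form2_lin _ _ (@linm_id _ _ _))).
have f3 : normal_mass 0 s.2 = 0 :> R.
  exact: (lin0 (lin_normal_massl _ (@linm_id _ _ _))).
have f4 : form4 alpha s.1.1.1 s.1.2 0 = 0.
  exact: (lin0 (form4_lin _ _ (@linm_id _ _ _))).
move=> hd1 hd2; have d10 := lin0 hd1; have d20 := lin0 hd2.
split=> [h|[h1 h2 h3 h4] t /admissibleP [t1 t2 t3 t4]]; last first.
  by rewrite /form h1 // h2 // h3 // h4 // !addr0.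
have r0 k : row k (0 : vecf) = 0 by exact: row0.
have z0 k : (0 : scal) k 0 = 0 by rewrite mxE.
split=> [X X0|Y Y0|r r'0|Z Z0].
- have := h (X, 0, 0, 0); rewrite /form /= f2 f3 f4 d20 !addr0; apply.
  by apply/admissibleP; split.
- have := h (0, Y, 0, 0); rewrite /form /= f1 f3 f4 d10 !addr0 !add0r; apply.
  by apply/admissibleP; split.
- have := h (0, 0, r, 0); rewrite /form /= f1 f2 f4 d10 d20 !addr0 !add0r; apply.
  by apply/admissibleP; split.
- have := h (0, 0, 0, Z); rewrite /form /= f1 f2 f3 d10 d20 !addr0 !add0r; apply.
  by apply/admissibleP; split.
Qed.

Hypotheses (hdt : 0 < dt) (halpha : 0 <= alpha).
Hypothesis conn : connected (Gam T).
Hypothesis A2 : \dim <<[seq vertex_normal k | k : K in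
  [pred k | `[< free_vertex k >]]]>>%VS = n.+2.
Hypothesis A3 : forall k, free_vertex k -> vertex_normal k <> 0.

Lemma form_injective (s : trial) : s \in admissible ->
  (forall t, t \in admissible -> form s t = 0) -> s = 0.
Proof.
move=> /admissibleP [W0 Q0 L0 P0] fs.
have lin_zero : lin (fun _ : vecf => 0 : R) by move=> c u v; rewrite mulr0 addr0.
have /(form_components _ lin_zero lin_zero) [h1 h2 h3 h4] :
    forall t, t \in admissible -> form s t = 0 + 0.
  by move=> t tA; rewrite fs ?addr0.
have [] := homogeneous_trivial hT A1 hdt halpha conn A2 A3 W0 Q0 L0 P0 h1 h2 h3 h4.
by case: s {W0 Q0 L0 P0 fs h1 h2 h3 h4} => [[[? ?] ?] ?] /= -> -> -> ->.
Qed.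

Hypothesis hkm : vec (V T) km.
Hypothesis hkap : V T kap.
Hypothesis n1 : (n <= 1)%N.
Variable M : E -> E.
Hypothesis MV : vec (V T) M.
Hypothesis muM : forall x, bd2 T x -> mu x = M x.

Lemma data1_lin : lin data1.
Proof. exact: Rh_lin. Qed.

Lemma data2_lin : lin data2.
Proof.
apply: linD; last first.
  apply: linN; apply: lin_simp_sum => j; apply: lin_frobr; apply: linm_gradv.
  exact: linm_id.
apply: linD; first exact: boundary_lin muM.
by apply: linN; apply: lin_normal_massr; exact: linm_id.
Qed.

Lemma data_lin : lin data.
Proof.
apply: linD.
  exact: (@lin_comp _ _ _ data1 (fun s : trial => s.1.1.1) data1_lin).
exact: (@lin_comp _ _ _ data2 (fun s : trial => s.1.1.2) data2_lin).
Qed.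

Lemma tends_at_pt j l (f : E -> E) : vec (V T) f ->
  tendsm j l f (at_pt (nodalv T f) j l).
Proof. by move=> fV; rewrite -at_ptE; exact: tendsm_V. Qed.

Lemma tends_nodal j l (f : E -> R) : V T f ->
  tends j l f (nodal T f (simp j l) 0).
Proof. by move=> fV; rewrite mxE; exact: tends_V. Qed.

Lemma dirichletE (f g : E -> E) : vec (V T) f -> vec (V T) g ->
  L2 (fun j x => frob (sgradv f j x) (sgradv g j x)) =
  dirichlet (nodalv T f) (nodalv T g).
Proof. by move=> fV gV; apply: L2E => // j x jx; rewrite !sgradv_V. Qed.

Lemma tangentialE (f g : E -> E) : vec (V T) f -> vec (V T) g ->
  lumped (fun j x => dotv (Pv j (f x)) (g x)) =
  tangential (nodalv T f) (nodalv T g).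
Proof.
move=> fV gV; apply: lumpedE => // j l.
apply: tends_dotv; last exact: tends_at_pt.
apply: tendsm_tr; apply: tendsm_mul; first exact: tendsm_cst.
by apply: tendsm_tr; exact: tends_at_pt.
Qed.

Lemma normal_massE (r : E -> R) (g : E -> E) : V T r -> vec (V T) g ->
  lumped (fun j x => dotv (r x *: nu j) (g x)) =
  normal_mass (nodal T r) (nodalv T g).
Proof.
move=> rV gV; apply: lumpedE => // j l; rewrite -dotvZl.
apply: tends_dotv; last exact: tends_at_pt.
by apply: tendsmZ; [exact: tends_nodal|exact: tendsm_cst].
Qed.

(** Finite element fields are determined by their nodal values, and every
integral of the scheme is computed from these. *)
Lemma schemeE (w k : E -> E) (lam : E -> R) (p : E -> E) :
  vec (V T) w -> vec (V T) k -> V T lam -> vec (V T) p ->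
  willmore_scheme T dt alpha km kap mu w k lam p <->
  (forall t, t \in admissible ->
    form (nodalv T w, nodalv T k, nodal T lam, nodalv T p) t = data t).
Proof.
move=> wV kV lV pV; rewrite (form_components _ data1_lin data2_lin) /=.
have e1 chi : vec (V T) chi ->
    lumped (fun (j : J) x => dotv (w x) (nu j) * dotv (chi x) (nu j))
    - Bh T km k kap chi + lumped (fun (j : J) x => dotv (Pv j (chi x)) (p x))
    + alpha * L2 (fun (j : J) x => frob (sgradv chi j x) (sgradv p j x)) =
    form1 alpha (nodalv T w) (nodalv T k) (nodalv T p) (nodalv T chi)
    - data1 (nodalv T chi).
  move=> cV; rewrite /Bh !dirichletE // tangentialE // /data1 nodalvK //.
  rewrite (@lumpedE _ _ _ hT A1 _ (fun j l => dotv (at_pt (nodalv T w) j l) (nu j) *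
     dotv (at_pt (nodalv T chi) j l) (nu j))); last first.
    move=> j l; apply: tendsM => //.
      by apply: tends_dotv => //; [exact: tends_at_pt|exact: tendsm_cst].
    by apply: tends_dotv => //; [exact: tends_at_pt|exact: tendsm_cst].
  by rewrite /form1; ring.
have e2 eta : vec (V T) eta ->
    lumped (fun (j : J) x => dotv (k x + kap x *: nu j) (eta x))
    + L2 (fun (j : J) x => frob (sgradv (fun y => y + dt *: w y) j x) (sgradv eta j x))
    - L2_bd2 T (fun x => dotv (mu x) (eta x)) =
    form2 dt (nodalv T w) (nodalv T k) (nodalv T eta) - data2 (nodalv T eta).
  move=> eV; rewrite /data2 nodalvK //.
  rewrite (@lumpedE _ _ _ hT A1 _ (fun j l =>
      dotv (at_pt (nodalv T k) j l) (at_pt (nodalv T eta) j l) +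
      nodal T kap (simp j l) 0 * dotv (nu j) (at_pt (nodalv T eta) j l))); last first.
    move=> j l; rewrite -dotvZl -dotvDl; apply: tends_dotv => //.
      apply: tendsmD => //; first exact: tends_at_pt.
      by apply: tendsmZ; [exact: tends_nodal|exact: tendsm_cst].
    exact: tends_at_pt.
  rewrite (@L2E _ _ _ hT A1 _ (fun j => dt * frob (gradv (nodalv T w) j)
      (gradv (nodalv T eta) j) + frob (Pmx j) (gradv (nodalv T eta) j))); last first.
    move=> j x jx; rewrite sgradv_idD // sgradv_V // addrC.
    exact: (lin_frobl _ (@linm_id _ _ _)).
  rewrite lumpD simp_sum_linear /form2 /dirichlet -/(normal_mass (nodal T kap) (nodalv T eta)).
  ring.
have V0V f : vec (V0 T) f -> vec (V T) f by move=> fV i; case: (fV i).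
have V1V f : vec (V1 T) f -> vec (V T) f by move=> fV i; case: (fV i).
split=> [h|[h1 h2 h3 h4] chi eta rho xi cV eV rV xV].
  have h' X Y r Z := h (interpv X) (interpv Y) (interp r) (interpv Z).
  have row_z k' : row k' (0 : vecf) = 0 by exact: row0.
  have O0 : vec (V0 T) (interpv (0 : vecf)) by exact: vecV0_interpv.
  have O1 : vec (V1 T) (interpv (0 : vecf)) by exact: vecV1_interpv.
  have o0 : V0 T (interp (0 : scal)).
    by apply: V0_interp => // k' _; rewrite mxE.
  split=> [X X0|Y Y0|r r0|Z Z0].
  - have XV := vecV0_interpv hT A1 X0.
    have [+ _ _ _] := h' X 0 0 0 XV O1 o0 O0.
    rewrite e1; last exact: V0V.
    by rewrite interpvK // => /eqP; rewrite eq_sym subr_eq0 => /eqP.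
  - have YV := vecV1_interpv hT A1 Y0.
    have [_ + _ _] := h' 0 Y 0 0 O0 YV o0 O0.
    rewrite e2; last exact: V1V.
    by rewrite interpvK // => /eqP; rewrite eq_sym subr_eq0 => /eqP.
  - have rV := V0_interp hT A1 r0.
    have [_ _ + _] := h' 0 0 r 0 O0 O1 rV O0.
    by rewrite normal_massE ?interpK //; case: rV.
  - have ZV := vecV0_interpv hT A1 Z0.
    have [_ _ _ +] := h' 0 0 0 Z O0 O1 o0 ZV.
    have ZV' := V0V _ ZV.
    by rewrite tangentialE // normal_massE // dirichletE // interpvK.
have row_nodal_eq0 (f : E -> E) (B : set E) : (forall i y, B y -> f y 0 i = 0) ->
    forall k' : K, B (vertex k') -> row k' (nodalv T f) = 0.
  by move=> fB k' kB; apply/rowP => i; rewrite row_nodalv fB // mxE.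
have cV' := V0V _ cV; have eV' := V1V _ eV; have xV' := V0V _ xV.
have [rV' r_bd] := rV.
split.
- rewrite e1 // h1 ?subrr //; apply: (row_nodal_eq0 _ (bd T)) => i.
  by have [_ +] := cV i.
- rewrite e2 // h2 ?subrr //; apply: (row_nodal_eq0 _ (bd1 T)) => i.
  by have [_ +] := eV i.
- by rewrite normal_massE // h3 // => k' kb; rewrite mxE r_bd.
- rewrite tangentialE // normal_massE // dirichletE //.
  apply/esym/h4; apply: (row_nodal_eq0 _ (bd T)) => i.
  by have [_ +] := xV i.
Qed.

End Solvability.

(** * Unique solvability *)

Theorem theorem5p2 (R : realType) (n : nat) (hd : n.+2 = 2%N \/ n.+2 = 3%N)
  (dt alpha : R) (hdt : 0 < dt) (halpha : 0 <= alpha)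
  (T : triangulation R n) (hT : polyhedral_surface T)
  (hconn : connected (Gam T))
  (km : 'rV[R]_n.+2 -> 'rV[R]_n.+2) (hkm : vec (V T) km)
  (kap : 'rV[R]_n.+2 -> R) (hkap : V T kap)
  (mu : 'rV[R]_n.+2 -> 'rV[R]_n.+2)
  (hmu : exists2 M, vec (V T) M & forall x, bd2 T x -> mu x = M x)
  (A1 : forall j, 0 < simp_measure (T := T) j)
  (A2 : \dim <<[seq vertex_normal k | k : 'I_(nvert T) in
                 [pred k | `[< free_vertex k >]]]>>%VS = n.+2)
  (A3 : forall k : 'I_(nvert T), free_vertex k -> vertex_normal k <> 0) :
  exists! s : ('rV[R]_n.+2 -> 'rV[R]_n.+2) * ('rV[R]_n.+2 -> 'rV[R]_n.+2) *
              ('rV[R]_n.+2 -> R) * ('rV[R]_n.+2 -> 'rV[R]_n.+2),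
    let: (w, k, lam, p) := s in
    [/\ vec (V0 T) w, vec (V1 T) k, V0 T lam & vec (V0 T) p] /\
    willmore_scheme T dt alpha km kap mu w k lam p.
Proof.
have n1 : (n <= 1)%N by case: hd => -[->].
have [M MV muM] := hmu.
have V0V f : vec (V0 T) f -> vec (V T) f by move=> fV i; case: (fV i).
have V1V f : vec (V1 T) f -> vec (V T) f by move=> fV i; case: (fV i).
have equiv w k lam p := @schemeE R n T hT A1 dt alpha km kap mu hkm hkap n1 M MV muM w k lam p.
have inj := @form_injective R n T hT A1 dt alpha hdt halpha hconn A2 A3.
have [[[[W Q] L] P] sA sE] := galerkin_solvable (form_linl dt alpha) (form_linr dt alpha)
  (data_lin hT A1 hkm hkap n1 MV muM) inj.
have /admissibleP [/= W0 Q0 L0 P0] := sA.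
exists (interpv W, interpv Q, interp L, interpv P); split.
  have wV := vecV0_interpv hT A1 W0; have kV := vecV1_interpv hT A1 Q0.
  have lV := V0_interp hT A1 L0; have pV := vecV0_interpv hT A1 P0.
  split=> //; apply/equiv; [exact: V0V|exact: V1V|by case: lV|exact: V0V|].
  by rewrite !interpvK // interpK.
move=> [[[w k] lam] p] [[wV0 kV1 lV0 pV0]].
have [wV kV pV] := And3 (V0V _ wV0) (V1V _ kV1) (V0V _ pV0).
have [lV l_bd] := lV0.
move=> /(equiv _ _ _ _ wV kV lV pV) sE'.
set s' := (_, _, _, _) in sE'.
have s'A : s' \in admissible T.
  apply/admissibleP; split=> k' k'b /=.
  - by apply/rowP => i; rewrite row_nodalv mxE; have [_ ->] := wV0 i.
  - by apply/rowP => i; rewrite row_nodalv mxE; have [_ ->] := kV1 i.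
  - by rewrite mxE l_bd.
  - by apply/rowP => i; rewrite row_nodalv mxE; have [_ ->] := pV0 i.
have e : (W, Q, L, P) = s'.
  apply/eqP; rewrite -subr_eq0; apply/eqP/inj => [|t tA]; first exact: memvB.
  by rewrite (linB _ _ (form_linl dt alpha t)) sE // sE' // subrr.
by case: e => -> -> -> ->; rewrite !nodalvK // nodalK.
Qed.
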